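(* Let $d\ge1$. For the von Mises--Fisher kernel $L_{\rm vMF}(t)=e^{-t}$, $t\ge0$, $$\tau_d(L_{\rm vMF})=\frac{2^{(5d+4)/(d+4)}\,\pi^{2d/(d+4)}}{d^{(d+8)/(d+4)}}\Big(1+2^{-(d/2+2)}-2(3/2)^{-(d/2+2)}\Big)\frac{d(d+2)}{(d+4)^2}.$$
   Context: For a kernel $L:[0,\infty)\to[0,\infty)$, the functional $\tau_d$ (the kernel contribution to the asymptotic variance of the cross-validation bandwidth selector on the sphere $\mathbb{S}^d$) is $$\tau_d(L)=\frac{1}{[2^{d-4}d^{d+8}]^{1/(d+4)}(d+4)^2}\cdot\frac{\sigma_0^2(L)}{[v_d(L)^{d+8}b_d(L)^{2d}]^{1/(d+4)}},$$ where, with $G(t)=L'(t)t$ and $\omega_d=2\pi^{(d+1)/2}/\Gamma((d+1)/2)$, $$\sigma_0^2(L)=16\Bigg\{\frac{\lambda_d(G^2)}{\lambda_d(L)^2}-\frac{2\gamma_d}{\lambda_d(L)^3}\int_0^\infty\!\!\int_0^\infty L(u)L(v)\varphi_{12,d}(L,u,v)u^{d/2}v^{d/2}\,du\,dv+\frac{\tilde\gamma_d}{\lambda_d(L)^4}\int_0^\infty\Big[\int_0^\infty L(u)\varphi_{1,d}(L,u,v)u^{d/2}\,du\Big]^2v^{d/2-1}\,dv\Bigg\},$$ $$\lambda_d(L)=2^{d/2-1}\omega_{d-1}\int_0^\infty L(s)s^{d/2-1}ds,\quad \beta_{d,2}(L)=2^{d/2}\omega_{d-1}\int_0^\infty L(s)s^{d/2}ds,\quad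 v_d(L)=\frac{\lambda_d(L^2)}{\lambda_d(L)^2},\quad b_d(L)=\frac{\beta_{d,2}(L)}{2d\,\lambda_d(L)},$$ $$\varphi_d(L,r,s)=\begin{cases}L(r+s-2(rs)^{1/2})+L(r+s+2(rs)^{1/2}),&d=1,\\ \int_{-1}^1(1-\theta^2)^{(d-3)/2}L(r+s-2\theta(rs)^{1/2})\,d\theta,&d\ge2,\end{cases}$$ $\varphi_{1,d}(L,u,v)=\frac{\partial}{\partial u}\varphi_d(L,u,v)$, $\varphi_{12,d}(L,u,v)=\frac{\partial}{\partial v}\frac{\partial}{\partial u}\varphi_d(L,u,v)$; $\gamma_1=1$, $\gamma_d=\omega_{d-1}\omega_{d-2}2^{d-2}$ for $d\ge2$; $\tilde\gamma_1=2^{-1/2}$, $\tilde\gamma_d=\omega_{d-1}\omega_{d-2}^2\,2^{(3d-6)/2}$ for $d\ge2$. *)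

(* Defs.v *)
From HB Require Import structures.
From mathcomp Require Import all_boot all_order all_algebra.
From mathcomp Require Import all_classical all_reals all_analysis.

Set Implicit Arguments.
Unset Strict Implicit.
Unset Printing Implicit Defensive.

Import Order.TTheory GRing.Theory Num.Theory.
Import numFieldNormedType.Exports.
Local Open Scope classical_set_scope.
Local Open Scope ring_scope.

(* A kernel [0, oo) -> [0, oo) is represented by a function L : R -> R. Every
   integral below ranges over nonnegative variables and evaluates L at
   nonnegative points only, so its values depend only on the restriction of L
   to [0, oo): the two-sided derivatives taken at a boundary point are values
   of integrands on null sets. All integrals are Lebesgue integrals, and
   double integrals are iterated. *)

Definition int0oo (R : realType) (f : R -> R) : R :=
  \int[@lebesgue_measure R]_(x in `[0, +oo[) f x.

(* Euler's integral, meaningful for a > 0. *)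
Definition Gamma (R : realType) (a : R) : R :=
  int0oo (fun t => t `^ (a - 1) * expR (- t)).

(* Surface area of the unit sphere of dimension d; omega R 0 = 2. *)
Definition omega (R : realType) (d : nat) : R :=
  2 * pi `^ ((d%:R + 1) / 2) / Gamma ((d%:R + 1) / 2).

Section kernel_functionals.
Variables (R : realType) (d : nat).
Implicit Type L : R -> R.

Definition lambda L : R :=
  2 `^ (d%:R / 2 - 1) * omega R d.-1
  * int0oo (fun s => L s * s `^ (d%:R / 2 - 1)).

Definition beta2 L : R :=
  2 `^ (d%:R / 2) * omega R d.-1 * int0oo (fun s => L s * s `^ (d%:R / 2)).

Definition v_ L : R := lambda (fun t => L t ^+ 2) / lambda L ^+ 2.

Definition b_ L : R := beta2 L / (2 * d%:R * lambda L).

Definition phi L (r s : R) : R :=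
  if d == 1%N then
    L (r + s - 2 * Num.sqrt (r * s)) + L (r + s + 2 * Num.sqrt (r * s))
  else
    \int[@lebesgue_measure R]_(theta in `[-1, 1])
      ((1 - theta ^+ 2) `^ ((d%:R - 3) / 2)
       * L (r + s - 2 * theta * Num.sqrt (r * s))).

Definition phi1 L (u v : R) : R := derive1 (fun x : R => phi L x v) u.

Definition phi12 L (u v : R) : R := derive1 (fun y : R => phi1 L u y) v.

Definition gamma : R :=
  if d == 1%N then 1
  else omega R d.-1 * omega R d.-2 * 2 `^ (d%:R - 2).

Definition gammat : R :=
  if d == 1%N then 2 `^ (- 2^-1)
  else omega R d.-1 * omega R d.-2 ^+ 2 * 2 `^ ((3 * d%:R - 6) / 2).

Definition G L (t : R) : R := derive1 L t * t.

Definition sigma2_0 L : R :=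
  16 * (lambda (fun t => G L t ^+ 2) / lambda L ^+ 2
        - 2 * gamma / lambda L ^+ 3
          * int0oo (fun v => int0oo (fun u =>
              L u * L v * phi12 L u v * u `^ (d%:R / 2) * v `^ (d%:R / 2)))
        + gammat / lambda L ^+ 4
          * int0oo (fun v =>
              int0oo (fun u => L u * phi1 L u v * u `^ (d%:R / 2)) ^+ 2
              * v `^ (d%:R / 2 - 1))).

Definition tau L : R :=
  1 / ((2 `^ (d%:R - 4) * d%:R ^+ (d + 8)%N) `^ (1 / (d%:R + 4))
       * (d%:R + 4) ^+ 2)
  * (sigma2_0 L
     / (v_ L ^+ (d + 8)%N * b_ L ^+ (2 * d)%N) `^ (1 / (d%:R + 4))).

End kernel_functionals.

Definition L_vMF (R : realType) (t : R) : R := expR (- t).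

(* Main.v *)
Require Import Defs.
From HB Require Import structures.
From mathcomp Require Import all_boot all_order all_algebra.
From mathcomp Require Import ring lra.
From mathcomp Require Import all_classical all_reals all_analysis.
From mathcomp Require Import measurable_realfun.

(* For L(t) = exp(-t), phi_d(u,v) is exp(-u-v) times a constant times the
   Bessel-Clifford function E_a(uv) = sum_k (uv)^k / (k! Gamma(a+k)), a = d/2:
   expand the exponential (even part only, by symmetry in theta) and integrate
   termwise against the beta weight. Since E_a' = E_(a+1), the derivatives
   phi_1 and phi_12 are combinations of E_a, E_(a+1), E_(a+2), whose Laplace
   transforms are elementary: the integral of u^(b-1) exp(-cu) E_b(uv) over u is
   c^(-b) exp(v/c), again by termwise integration. The inner integrals of
   sigma_0^2 thus become exp(-v/2) or exp(-3v/2) times polynomials and powers,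
   and the outer ones are Gamma integrals. *)

Set Implicit Arguments.
Unset Strict Implicit.
Unset Printing Implicit Defensive.

Import Order.TTheory GRing.Theory Num.Theory.
Import numFieldNormedType.Exports.
Local Open Scope classical_set_scope.
Local Open Scope ring_scope.

(** * Integrals with a prescribed value *)

(** The integral is a total function with a default value, so a value means little until
    integrability is known; the two therefore travel together throughout. Sums and integrals are
    exchanged only for nonnegative terms. This is why the exponential in [phi] is replaced by its
    even part: the odd terms of its series change sign with theta. The Laplace transform closes up
    only when the weight u^(b-1) matches the index b. The weight u^(d/2) of sigma_0^2 matches the
    index a + 1 but not a, and the differential equation of E_b, as a three-term recurrence, repairs
    the mismatch. The case d = 1, where [phi] is a sum of two values, obeys the same formula because
    cosh is an E_(1/2); only its constant differs. That constant is never evaluated inside the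
    integrals: multiplied by [gamma] or, squared, by [gammat], it gives expressions uniform in d, as
    Gamma((d-1)/2) cancels against omega_(d-2). *)

Section has_integral.
Context {R : realType}.
Notation mu := (@lebesgue_measure R).
Implicit Types (D : set (measurableTypeR R)) (f g F : R -> R).

(** [Rintegral] truncates an infinite integral to a real number, so the equation alone would not
    exclude divergence; integrability is also what linearity requires. *)
Definition has_integral D f (v : R) : Prop :=
  mu.-integrable D (EFin \o f) /\ \int[mu]_(x in D) f x = v.

Lemma has_integral_Rintegral D f v : has_integral D f v ->
  \int[mu]_(x in D) f x = v.
Proof. by case. Qed.

Lemma has_integralE D f v : measurable D -> has_integral D f v ->
  (\int[mu]_(x in D) (f x)%:E)%E = v%:E.
Proof.
move=> mD [fi <-]; rewrite /Rintegral fineK//; exact: integrable_fin_num.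
Qed.

Lemma has_integral_measurable D f v : has_integral D f v -> measurable_fun D f.
Proof. by move=> [/measurable_int/measurable_EFinP]. Qed.

Lemma eq_has_integral D f g v : measurable D -> (forall x, D x -> f x = g x) ->
  has_integral D f v -> has_integral D g v.
Proof.
move=> mD fg [fi <-]; split.
  by apply: eq_integrable fi => // x /set_mem Dx /=; rewrite fg.
by apply: eq_Rintegral => x /set_mem Dx; rewrite fg.
Qed.

Lemma has_integralD D f g u v : measurable D ->
  has_integral D f u -> has_integral D g v ->
  has_integral D (fun x => f x + g x) (u + v).
Proof.
move=> mD [fi <-] [gi <-]; split; last exact: RintegralD.
have := integrableD mD fi gi; apply: eq_integrable => // x _.
Qed.

Lemma has_integralZl D f v (k : R) : measurable D ->
  has_integral D f v -> has_integral D (fun x => k * f x) (k * v).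
Proof.
move=> mD [fi <-]; split; last exact: RintegralZl.
exact: (integrableZl mD k fi).
Qed.

Lemma has_integralB D f g u v : measurable D ->
  has_integral D f u -> has_integral D g v ->
  has_integral D (fun x => f x - g x) (u - v).
Proof.
move=> mD fu /(has_integralZl (-1) mD) gv; rewrite -mulN1r.
apply: (eq_has_integral mD _ (has_integralD mD fu gv)) => x _.
by rewrite mulN1r.
Qed.

Lemma ge0_has_integral D f v : measurable D -> measurable_fun D f ->
  (forall x, D x -> 0 <= f x) ->
  (\int[mu]_(x in D) (f x)%:E)%E = v%:E -> has_integral D f v.
Proof.
move=> mD mf f0 fv; split; last by rewrite /Rintegral fv.
apply/integrableP; split; first exact/measurable_EFinP.
under eq_integral => x /set_mem Dx do rewrite /= ger0_norm ?f0//.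
by rewrite fv ltry.
Qed.

Lemma le_has_integral D f g v : measurable D -> measurable_fun D f ->
  (forall x, D x -> `|f x| <= g x) -> has_integral D g v ->
  has_integral D f (\int[mu]_(x in D) f x).
Proof.
move=> mD mf fg [gi _]; split => //.
apply: (le_integrable mD _ _ gi) => [|x Dx /=]; first exact/measurable_EFinP.
by rewrite lee_fin (le_trans (fg x Dx))// ler_norm.
Qed.

(** Nonnegative terms make monotone convergence sufficient: no dominating function is needed, and
    integrability of g comes from the finiteness of l. *)
Lemma has_integral_series D (f_ : nat -> R -> R) (v_ : nat -> R) g l :
  measurable D -> (forall k x, D x -> 0 <= f_ k x) ->
  (forall k, has_integral D (f_ k) (v_ k)) ->
  series v_ @ \oo --> l ->
  (forall x, D x -> series (f_ ^~ x) @ \oo --> g x) ->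
  has_integral D g l.
Proof.
move=> mD f0 fv vl fg.
have mf k : measurable_fun D (fun x => (f_ k x)%:E).
  by apply/measurable_EFinP; exact: has_integral_measurable (fv k).
have sE x : D x -> (\sum_(0 <= k <oo) (f_ k x)%:E)%E = (g x)%:E.
  move=> Dx; apply/cvg_lim => //.
  have -> : (fun n => \sum_(0 <= k < n) (f_ k x)%:E)%E = EFin \o series (f_ ^~ x).
    by apply/funext => n /=; rewrite /series/= sumEFin.
  by apply: cvg_EFin; [exact: nearW|exact: fg].
have ig : (\int[mu]_(x in D) (g x)%:E)%E = l%:E.
  under eq_integral => x /set_mem Dx do rewrite -sE//.
  rewrite integral_nneseries//.
  under eq_eseriesr do rewrite (has_integralE mD (fv _)).
  apply/cvg_lim => //.
  have -> : (fun n => \sum_(0 <= k < n) (v_ k)%:E)%E = EFin \o series v_.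
    by apply/funext => n /=; rewrite /series/= sumEFin.
  by apply: cvg_EFin; [exact: nearW|].
have mg : measurable_fun D g.
  apply: (measurable_fun_cvg (h := fun n x => series (f_ ^~ x) n)) => // n.
  by apply: measurable_sum => k; exact: has_integral_measurable (fv k).
apply: ge0_has_integral => // x Dx.
have /cvg_lim <-// := fg x Dx; apply: limr_ge; first exact/cvgP/fg.
by apply: nearW => n; apply: sumr_ge0 => k _; exact: f0.
Qed.

End has_integral.

(** * The fundamental theorem of calculus on open intervals *)

Section exhaustion.
Context {R : realType}.
Notation mu := (@lebesgue_measure R).
Implicit Types (D : set (measurableTypeR R)) (f g F : R -> R) (a b : R^nat).

(* The library states the fundamental theorem and substitution for integrands
   continuous up to the end points; neither t^(a-1) at 0 nor (1-t^2)^(-1/2) at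
   1 is. *)
Definition exhaustion D a b : Prop :=
  [/\ forall n, a n < b n, nonincreasing_seq a, nondecreasing_seq b &
      \bigcup_n `[a n, b n]%classic = D].

Lemma exhaustion_measurable D a b : exhaustion D a b -> measurable D.
Proof. by case=> _ _ _ <-; exact: bigcup_measurable. Qed.

Lemma exhaustion_sub D a b n x : exhaustion D a b -> a n <= x <= b n -> D x.
Proof. by case=> _ _ _ <- xab; exists n => //=; rewrite in_itv. Qed.

Lemma exhaustion_within D a b f n : exhaustion D a b ->
  (forall x, D x -> {for x, continuous f}) ->
  {within `[a n, b n], continuous f}.
Proof.
move=> Dab cf; apply: continuous_in_subspaceT => x /set_mem /=.
by rewrite in_itv/= => xab; exact: cf (exhaustion_sub Dab xab).
Qed.

Lemma exhaustion_measurable_fun D a b f : exhaustion D a b ->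
  (forall x, D x -> {for x, continuous f}) -> measurable_fun D f.
Proof.
move=> Dab cf; have [_ _ _ <-] := Dab.
apply/measurable_fun_bigcup => // n.
apply: subspace_continuous_measurable_fun => //.
exact: exhaustion_within Dab cf.
Qed.

Lemma ge0_integral_exhaustion D a b f : exhaustion D a b ->
  (forall x, D x -> {for x, continuous f}) -> (forall x, D x -> 0 <= f x) ->
  (\int[mu]_(x in `[a n, b n]) (f x)%:E)%E @[n --> \oo] -->
  (\int[mu]_(x in D) (f x)%:E)%E.
Proof.
move=> Dab cf f0; have mf := exhaustion_measurable_fun Dab cf.
have [_ da ub DE] := Dab; rewrite -[X in integral _ X]DE.
apply: ge0_nondecreasing_set_cvg_integral => //.
- move=> m n mn; apply/subsetPset => x /=; rewrite !in_itv/= => /andP[ax xb].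
  by rewrite (le_trans (da _ _ mn))//= (le_trans xb)// ub.
- move=> n; apply/measurable_EFinP; apply: measurable_funS mf => //.
    exact: exhaustion_measurable Dab.
  by rewrite -DE => x abx; exists n.
- move=> n x /=; rewrite in_itv/= lee_fin => xab.
  exact/f0/(exhaustion_sub Dab xab).
Qed.

Lemma integral_exhaustion D a b f v : exhaustion D a b ->
  has_integral D f v ->
  \int[mu]_(x in `[a n, b n]) f x @[n --> \oo] --> v.
Proof.
move=> Dab fv; have mD := exhaustion_measurable Dab.
have mf := has_integral_measurable fv.
have [_ da ub DE] := Dab.
pose f_ n := EFin \o (f \_ `[a n, b n]).
have := @dominated_convergence _ _ _ mu D mD f_ (EFin \o f) (fun x => `|f x|%:E).
case.
- move=> n; apply/measurable_EFinP/measurable_restrict => //.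
  by apply: measurable_funS mf => //; exact: subIsetl.
- exact/measurable_EFinP.
- apply/aeW => x; rewrite -DE => -[N _ /=]; rewrite in_itv/= => /andP[ax xb].
  apply: cvg_near_cst; exists N => // n /= Nn.
  rewrite /f_/= patchE mem_set//= in_itv/=.
  by rewrite (le_trans (da _ _ Nn))//= (le_trans xb)// ub.
- by have [/integrable_abse] := fv.
- apply/aeW => x n Dx; rewrite /f_/= patchE.
  by case: ifPn => _; rewrite lee_fin ?lexx// normr0.
move=> _ _; rewrite (has_integralE mD fv) => /fine_cvg.
apply: cvg_trans; apply: near_eq_cvg; apply: nearW => n /=.
rewrite -[LHS]/(\int[mu]_(x in D) (f \_ `[a n, b n]) x) -Rintegral_mkcondr.
by rewrite setIidr// -DE => x abx; exists n.
Qed.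

Lemma segment_FTC2 D a b f F n : exhaustion D a b ->
  (forall x, D x -> {for x, continuous f}) ->
  (forall x, D x -> is_derive x 1 F (f x)) ->
  (\int[mu]_(x in `[a n, b n]) (f x)%:E)%E = (F (b n) - F (a n))%:E.
Proof.
move=> Dab cf dF; have [ltab _ _ _] := Dab.
have cF x : D x -> {for x, continuous F}.
  move=> Dx; apply: differentiable_continuous; apply/derivable1_diffP.
  by apply: ex_derive; exact: dF.
have [Da Db] : D (a n) /\ D (b n).
  by split; apply: (exhaustion_sub Dab (n := n)); rewrite lexx ltW.
rewrite (@continuous_FTC2 _ f F)//.
- exact: exhaustion_within Dab cf.
- split.
  + move=> x; rewrite in_itv/= => /andP[ax xb].
    have Dx : D x by apply: (exhaustion_sub Dab (n := n)); rewrite !ltW.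
    by apply: ex_derive; exact: dF.
  + exact/cvg_at_right_filter/cF.
  + exact/cvg_at_left_filter/cF.
- move=> x; rewrite in_itv/= => /andP[ax xb].
  have Dx : D x by apply: (exhaustion_sub Dab (n := n)); rewrite !ltW.
  by rewrite derive1E; apply: derive_val; exact: dF.
Qed.

Lemma ge0_FTC2_exhaustion D a b f F l : exhaustion D a b ->
  (forall x, D x -> {for x, continuous f}) -> (forall x, D x -> 0 <= f x) ->
  (forall x, D x -> is_derive x 1 F (f x)) ->
  F (b n) - F (a n) @[n --> \oo] --> l -> has_integral D f l.
Proof.
move=> Dab cf f0 dF Fl; apply: ge0_has_integral => //.
- exact: exhaustion_measurable Dab.
- exact: exhaustion_measurable_fun Dab cf.
apply: (cvg_unique _ (ge0_integral_exhaustion Dab cf f0)) => //.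
rewrite (_ : (fun n => _) = EFin \o (fun n => F (b n) - F (a n))).
  by apply: cvg_EFin; first exact: nearW.
by apply/funext => n; exact: segment_FTC2 Dab cf dF.
Qed.

(** A bounded primitive gives finiteness without any limit at the end points; it produces dominating
    functions whose integral need not be known. *)
Lemma ge0_integrable_exhaustion D a b f F M : exhaustion D a b ->
  (forall x, D x -> {for x, continuous f}) -> (forall x, D x -> 0 <= f x) ->
  (forall x, D x -> is_derive x 1 F (f x)) ->
  (forall x, D x -> 0 <= F x <= M) ->
  has_integral D f (\int[mu]_(x in D) f x).
Proof.
move=> Dab cf f0 dF FM; have mD := exhaustion_measurable Dab.
have mf := exhaustion_measurable_fun Dab cf.
have [ltab _ _ _] := Dab.
have fM : (\int[mu]_(x in D) (f x)%:E <= M%:E)%E.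
  have fl := ge0_integral_exhaustion Dab cf f0.
  move/cvg_lim : (fl) => <-//; apply: lime_le; first exact/cvgP/fl.
  apply: nearW => n; rewrite (segment_FTC2 n Dab cf dF) lee_fin.
  have /FM/andP[_ Fb] : D (b n).
    by apply: (exhaustion_sub Dab (n := n)); rewrite lexx ltW.
  have /FM/andP[Fa _] : D (a n).
    by apply: (exhaustion_sub Dab (n := n)); rewrite lexx ltW.
  by rewrite lerBlDr (le_trans Fb)// lerDl.
apply: ge0_has_integral => //; rewrite /Rintegral fineK// ge0_fin_numE.
  exact: le_lt_trans fM (ltry _).
by apply: integral_ge0 => x Dx; rewrite lee_fin f0.
Qed.

(** For an f of varying sign, convergence of F (b n) - F (a n) does not imply integrability, so this
    only identifies a value. It carries the integrations by parts in [GammaD1] and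
    [beta_moment_half], where l = 0. *)
Lemma FTC2_exhaustion D a b f F l v : exhaustion D a b ->
  (forall x, D x -> {for x, continuous f}) ->
  (forall x, D x -> is_derive x 1 F (f x)) ->
  F (b n) - F (a n) @[n --> \oo] --> l -> has_integral D f v -> v = l.
Proof.
move=> Dab cf dF Fl fv; apply: (cvg_unique _ (integral_exhaustion Dab fv)) => //.
apply: cvg_trans Fl; apply: near_eq_cvg; apply: nearW => n.
by rewrite /Rintegral (segment_FTC2 n Dab cf dF).
Qed.

(** The change of variables is made on each closed piece [[a n, b n]], where all functions are
    continuous; nonnegativity lets both sides pass to the limit by monotone convergence, so
    integrability of f over E is a conclusion. *)
Lemma substitution_exhaustion D a b E g dg f v : exhaustion D a b ->
  exhaustion E (g \o a) (g \o b) ->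
  (forall x y, D x -> D y -> x < y -> g x < g y) ->
  (forall x, D x -> {for x, continuous dg}) ->
  (forall x, D x -> is_derive x 1 g (dg x)) ->
  (forall y, E y -> {for y, continuous f}) ->
  (forall y, E y -> 0 <= f y) -> (forall x, D x -> 0 <= dg x) ->
  has_integral D (fun x => f (g x) * dg x) v -> has_integral E f v.
Proof.
move=> Dab Eab incg cdg gdg cf f0 dg0 fgv.
have [ltab _ _ _] := Dab.
have cg x : D x -> {for x, continuous g}.
  move=> Dx; apply: differentiable_continuous; apply/derivable1_diffP.
  by apply: ex_derive; exact: gdg.
have Dgx x : D x -> E (g x).
  have [_ _ _ <-] := Dab; move=> [n _ /=]; rewrite in_itv/= => /andP[ax xb].
  have Dx : D x by apply: (exhaustion_sub Dab (n := n)); rewrite ax.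
  have Dan : D (a n) by apply: (exhaustion_sub Dab (n := n)); rewrite lexx ltW.
  have Dbn : D (b n) by apply: (exhaustion_sub Dab (n := n)); rewrite lexx ltW.
  have incgW y z : D y -> D z -> y <= z -> g y <= g z.
    by move=> Dy Dz; rewrite le_eqVlt => /predU1P[->//|yz]; rewrite ltW// incg.
  by apply: (exhaustion_sub Eab (n := n)); rewrite /= !incgW.
have fgD x : D x -> {for x, continuous (fun x => f (g x) * dg x)}.
  move=> Dx; apply: (@continuousM _ _ (f \o g)); last exact: cdg.
  by apply: continuous_comp; [exact: cg|exact/cf/Dgx].
apply: ge0_has_integral => //.
- exact: exhaustion_measurable Eab.
- exact: exhaustion_measurable_fun Eab cf.
apply: (cvg_unique _ (ge0_integral_exhaustion Eab cf f0)) => //.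
rewrite -(has_integralE (exhaustion_measurable Dab) fgv).
have fg0 x : D x -> 0 <= f (g x) * dg x.
  by move=> Dx; rewrite mulr_ge0 ?dg0//; exact/f0/Dgx.
apply: cvg_trans (ge0_integral_exhaustion Dab fgD fg0).
apply: near_eq_cvg; apply: nearW => n /=; apply/esym.
have Dn x : a n <= x <= b n -> D x by exact: exhaustion_sub Dab.
have dgE x : a n <= x <= b n -> derive1 g x = dg x.
  by move=> /Dn Dx; rewrite derive1E; apply: derive_val; exact: gdg.
rewrite integration_by_substitution_increasing.
- by apply: eq_integral => x /set_mem/=; rewrite in_itv/= => /dgE xE;
    rewrite -xE.
- exact: ltW.
- move=> x y; rewrite !in_itv/= => /Dn Dx /Dn Dy; exact: incg.
- move=> x xab; have cdgx : {for x, continuous dg}.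
    by apply: cdg; apply: Dn; move: xab; rewrite in_itv/= => /andP[? ?];
      rewrite !ltW.
  rewrite /continuous_at dgE; last first.
    by move: xab; rewrite in_itv/= => /andP[? ?]; rewrite !ltW.
  apply: cvg_trans cdgx; apply: near_eq_cvg; near=> y.
  apply/esym/dgE; have : y \in `]a n, b n[ by near: y; exact: near_in_itvoo.
  by rewrite in_itv/= => /andP[? ?]; rewrite !ltW.
(* [derive1 g] is known to equal [dg] only on D; its one-sided limit at an end of the piece is
   transported from the continuous [dg]. *)
- apply: (@cvgP _ _ (dg (a n))); apply: cvg_trans; last first.
    by apply: cvg_at_right_filter; apply: cdg; apply: Dn; rewrite lexx ltW.
  apply: near_eq_cvg; near=> y; apply/esym/dgE; apply/andP; split.
    by near: y; exact: nbhs_right_ge.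
  by near: y; exact: nbhs_right_le.
- apply: (@cvgP _ _ (dg (b n))); apply: cvg_trans; last first.
    by apply: cvg_at_left_filter; apply: cdg; apply: Dn; rewrite lexx ltW.
  apply: near_eq_cvg; near=> y; apply/esym/dgE; apply/andP; split.
    by near: y; exact: nbhs_left_ge.
  by near: y; exact: nbhs_left_le.
- split.
  + move=> x; rewrite in_itv/= => /andP[ax xb].
    have Dx : D x by apply: Dn; rewrite !ltW.
    by apply: ex_derive; exact: gdg.
  + by apply/cvg_at_right_filter/cg/Dn; rewrite lexx ltW.
  + by apply/cvg_at_left_filter/cg/Dn; rewrite lexx ltW.
- exact: (exhaustion_within Eab cf).
Unshelve. all: by end_near. Qed.

(** * Exhausting sequences for the half-line and for (-1, 1) *)

Lemma exhaustion_itv0y a b : (forall n, 0 < a n) -> (forall n, a n < b n) ->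
  nonincreasing_seq a -> nondecreasing_seq b ->
  a n @[n --> \oo] --> 0 -> b n @[n --> \oo] --> +oo ->
  exhaustion `]0, +oo[ a b.
Proof.
move=> a0 ab da ub cva cvb; split => //; apply/seteqP;
  split => [x [n _] /=|x /=].
  by rewrite !in_itv/= andbT => /andP[+ _]; exact: lt_le_trans.
rewrite in_itv/= andbT => x0.
have : \forall n \near \oo, a n <= x <= b n.
  near=> n; apply/andP; split.
    by near: n; exact: cvgr_le cva _ _.
  by near: n; move/cvgryPge: cvb; exact.
by case=> N _ /(_ N (leqnn N)) xN; exists N => //=; rewrite in_itv.
Unshelve. all: by end_near. Qed.

Lemma cvg_invn2 : n.+2%:R^-1 @[n --> \oo] --> (0 : R).
Proof. by rewrite (cvg_shiftS (@harmonic R)); exact: cvg_harmonic. Qed.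

Lemma cvg_n2 : n.+2%:R @[n --> \oo] --> (+oo : set_system R).
Proof.
rewrite (cvg_shiftS (fun n => n.+1%:R : R)) (cvg_shiftS (fun n => n%:R : R)).
exact: cvgr_idn.
Qed.

(** The shift to n + 2 keeps the pieces nondegenerate at n = 0: with n + 1 the first one would be
    reduced to the point 1. *)
Lemma exhaustion0y :
  exhaustion `]0, +oo[ (fun n => n.+2%:R^-1) (fun n => n.+2%:R).
Proof.
apply: exhaustion_itv0y => //.
- by move=> n; rewrite (@lt_trans _ _ 1)// ?invf_lt1 ?ltr1n.
- by move=> m n mn; rewrite lef_pV2 ?posrE// ler_nat.
- by move=> m n mn; rewrite ler_nat.
- exact: cvg_invn2.
- exact: cvg_n2.
Qed.

Lemma cvg_exhaustion0y F l0 l1 :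
  F x @[x --> 0^'+] --> l0 -> F x @[x --> +oo] --> l1 ->
  F n.+2%:R - F n.+2%:R^-1 @[n --> \oo] --> l1 - l0.
Proof.
move=> F0 F1; apply: cvgB; first exact: cvg_comp cvg_n2 F1.
move/cvg_at_rightP : F0; apply; split => [n|]; first by rewrite invr_gt0.
exact: cvg_invn2.
Qed.

Lemma exhaustionN11 :
  exhaustion `](-1), 1[ (fun n => - (1 - n.+2%:R^-1)) (fun n => 1 - n.+2%:R^-1).
Proof.
have n2 n : (n.+2%:R^-1 : R) < 1 by rewrite invf_lt1 ?ltr1n.
have n0 n : 0 < (n.+2%:R^-1 : R) by rewrite invr_gt0.
have nI m n : (m <= n)%N -> (n.+2%:R^-1 : R) <= m.+2%:R^-1.
  by move=> mn; rewrite lef_pV2 ?posrE// ler_nat.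
split.
- by move=> n; have := n2 n; have := n0 n; rewrite -subr_gt0;
    move: (n.+2%:R^-1 : R) => y; lra.
- by move=> m n /nI; rewrite ?lerN2 ?lerD2l ?lerN2.
- by move=> m n /nI; rewrite ?lerN2 ?lerD2l ?lerN2.
apply/seteqP; split => [x [n _] /=|x /=].
  rewrite !in_itv/=; move: (n.+2%:R^-1 : R) (n0 n) => y ? /andP[? ?];
    apply/andP; split; lra.
rewrite in_itv/= => /andP[xN1 x1].
(* e is the distance from x to the nearer end point, and N is chosen so that 1/(N+2) does not exceed
   it. *)
pose e : R := Num.min (1 + x) (1 - x).
have e0 : 0 < e by rewrite /e lt_min; apply/andP; split; lra.
pose N := Num.bound e^-1.
have Ne : N.+2%:R^-1 <= e.
  rewrite -[leRHS]invrK lef_pV2 ?posrE ?invr_gt0//.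
  rewrite (le_trans (ltW (archi_boundP _)))// ?invr_ge0 1?ltW//.
  by rewrite ltr_nat.
have [ex1 ex2] : e <= 1 + x /\ e <= 1 - x by rewrite !ge_min !lexx orbT.
exists N => //=; rewrite in_itv/=; move: (N.+2%:R^-1 : R) Ne => y ?.
by apply/andP; split; lra.
Qed.

End exhaustion.

(** * The Gamma function *)

(* Sealed, so that conversion never unfolds the integral. *)
HB.lock Definition euler_gamma {R : realType} (a : R) : R := Gamma a.

Section Gamma.
Context {R : realType}.
Notation mu := (@lebesgue_measure R).
Implicit Types (a b c t u v x : R).

Lemma has_integral_int0oo (f : R -> R) v :
  has_integral `]0, +oo[ f v -> int0oo f = v.
Proof.
move=> fv; rewrite /int0oo -(has_integral_Rintegral fv) Rintegral_itv_obnd_cbnd//.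
by case: fv.
Qed.

Lemma eq_has_integral0y (f g : R -> R) v : (forall x, 0 < x -> f x = g x) ->
  has_integral `]0, +oo[ f v -> has_integral `]0, +oo[ g v.
Proof.
move=> fg; apply: eq_has_integral => // x /=; rewrite in_itv/= andbT; exact: fg.
Qed.

Lemma gt0_powRD x b c : 0 < x -> x `^ (b + c) = x `^ b * x `^ c.
Proof. by move=> x0; rewrite powRD// (gt_eqF x0) implybT. Qed.

(** With z = (1 + t)/(a + 1), this is z <= exp z raised to the power a + 1. It serves both to
    dominate the Gamma integrand and to make boundary terms vanish at infinity. *)
Lemma powR_expR_le a t : 0 <= a -> 0 <= t ->
  expR (- t) * (1 + t) `^ (a + 1) <= (a + 1) `^ (a + 1) * expR 1.
Proof.
move=> a0 t0; have a1 : 0 < a + 1 by rewrite ltr_wpDl.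
have z0 : 0 <= (1 + t) / (a + 1) by rewrite divr_ge0 ?addr_ge0// ltW.
rewrite mulrC expRN ler_pdivrMr ?expR_gt0// -mulrA -expRD.
have -> : 1 + t = (a + 1) * ((1 + t) / (a + 1)) by field; rewrite gt_eqF.
rewrite powRM ?(ltW a1)// ler_wpM2l ?powR_ge0//.
rewrite [X in expR X]mulrC expRM; apply: ge0_ler_powR;
  rewrite ?nnegrE ?expR_ge0 ?(ltW a1)//.
by apply: le_trans (expR_ge1Dx _); rewrite lerDr.
Qed.

Lemma continuous_powR_gt0 a x : 0 < x -> {for x, continuous (@powR R ^~ a)}.
Proof.
move=> x0; apply: differentiable_continuous; apply/derivable1_diffP.
by apply: ex_derive; exact: is_derive1_powR.
Qed.

Lemma continuous_powRM_expRN a c x : 0 < x ->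
  {for x, continuous (fun t => t `^ a * expR (- (c * t)))}.
Proof.
move=> x0; apply: continuousM; first exact: continuous_powR_gt0.
apply: (@continuous_comp _ _ _ (fun t => - (c * t)) expR);
  last exact: continuous_expR.
by apply: continuousN; apply: continuousM => //; exact: cvg_cst.
Qed.

Lemma continuous_powR_expRN a x : 0 < x ->
  {for x, continuous (fun t => t `^ a * expR (- t))}.
Proof.
move=> x0; have := @continuous_powRM_expRN a 1 x x0.
rewrite (_ : (fun t => _) = (fun t => t `^ a * expR (- t)))//.
by apply/funext => t; rewrite mul1r.
Qed.

Lemma has_integral_Gamma a : 0 < a ->
  has_integral `]0, +oo[ (fun t => t `^ (a - 1) * expR (- t)) (euler_gamma a).
Proof.
move=> a0.
(* The integrand is dominated by a multiple of the derivative g of the bounded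
   function F(t) = (t / (1 + t))^a. *)
pose g t := a * t `^ (a - 1) * (1 + t) `^ (- a - 1).
pose F t := t `^ a * (1 + t) `^ (- a).
have gF t : (0 < t) -> is_derive t 1 F (g t).
  move=> t0; have t1 : 0 < 1 + t by rewrite addr_gt0.
  have d1 : is_derive t 1 (fun t : R => 1 + t) 1.
    by apply: trigger_derive; rewrite add0r mulr1.
  have := @is_derive1_comp R (@powR R ^~ (- a)) _ t _ _ (is_derive1_powR (- a) t1) d1.
  move=> d2; apply: (is_derive_eq (is_deriveM (is_derive1_powR a t0) d2)).
  rewrite /g mulr1 /GRing.scale/=.
  rewrite !gt0_powRD// !powRN !powRr1 ?ltW//.
  by have pt0 := powR_gt0 a t0; have pt1 := powR_gt0 a t1; field;
    rewrite !gt_eqF.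
have cg t : 0 < t -> {for t, continuous g}.
  move=> t0; apply: continuousM.
    by apply: continuousM; [exact: cvg_cst|exact: continuous_powR_gt0].
  apply: (@continuous_comp _ _ _ (fun t => 1 + t) (@powR R ^~ (- a - 1))).
    by apply: continuousD => //; exact: cvg_cst.
  by apply: continuous_powR_gt0; rewrite addr_gt0.
have gi : has_integral `]0, +oo[ g (\int[mu]_(x in `]0, +oo[) g x).
  apply: (ge0_integrable_exhaustion exhaustion0y (F := F) (M := 1)) => t /=.
  - by rewrite in_itv/= andbT; exact: cg.
  - by rewrite in_itv/= andbT => t0; rewrite !mulr_ge0 ?powR_ge0// ltW.
  - by rewrite in_itv/= andbT; exact: gF.
  - rewrite in_itv/= andbT => t0; rewrite mulr_ge0 ?powR_ge0//=.
    rewrite /F powRN ler_pdivrMr ?powR_gt0 ?addr_gt0// mul1r.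
    by apply: ge0_ler_powR; rewrite ?nnegrE ?addr_ge0 ?ltW// ltrDr.
(* The multiple is the constant of [powR_expR_le], which absorbs the factor (1 + t)^(-a-1) of g,
   divided by the factor a of g. *)
have := @le_has_integral _ `]0, +oo[%classic (fun t => t `^ (a - 1) * expR (- t)).
move=> /(_ _ _ _ _ _ (has_integralZl ((a + 1) `^ (a + 1) * expR 1 / a) _ gi)) H.
have fi : has_integral `]0, +oo[ (fun t => t `^ (a - 1) * expR (- t))
    (\int[mu]_(t in `]0, +oo[) (t `^ (a - 1) * expR (- t))).
  apply: H => //.
    apply: (exhaustion_measurable_fun exhaustion0y) => t /=.
    by rewrite in_itv/= andbT; exact: continuous_powR_expRN.
  move=> t /=; rewrite in_itv/= andbT => t0.
  rewrite ger0_norm ?mulr_ge0 ?powR_ge0 ?expR_ge0// /g.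
  have t1 : 0 < 1 + t by rewrite addr_gt0.
  rewrite -opprD powRN -[X in _ <= X](_ : t `^ (a - 1) *
    ((a + 1) `^ (a + 1) * expR 1 / (1 + t) `^ (a + 1)) = _).
    rewrite ler_wpM2l ?powR_ge0// ler_pdivlMr ?powR_gt0//.
    by apply: powR_expR_le; exact: ltW.
  by have pt1 := powR_gt0 (a + 1) t1; field; rewrite !gt_eqF.
rewrite euler_gamma.unlock /Gamma.
by have := fi; rewrite -(has_integral_int0oo fi).
Qed.

Lemma Gamma_gt0 a : 0 < a -> 0 < euler_gamma a.
Proof.
move=> a0; have fi := has_integral_Gamma a0.
have fE := has_integralE (measurable_itv _) fi.
have mf := has_integral_measurable fi.
(* On [1, 2], which has length 1, the integrand is at least c: there 0 <= ln x <= x <= 2, so x^(a-1)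
   >= exp(-2|a-1|), and exp(-x) >= exp(-2). *)
pose c := expR (- (2 * `|a - 1| + 2)).
suff : (c%:E <= (euler_gamma a)%:E)%E
  by rewrite lee_fin; apply: lt_le_trans; exact: expR_gt0.
rewrite -fE.
apply: (@le_trans _ _ (\int[mu]_(x in `[1%R, 2%R]) (x `^ (a - 1) * expR (- x))%:E)%E); last first.
  apply: ge0_subset_integral => //.
  - exact/measurable_EFinP.
  - by move=> x _; rewrite lee_fin mulr_ge0 ?powR_ge0 ?expR_ge0.
  - move=> x /=; rewrite !in_itv/= andbT => /andP[x1 _].
    exact: lt_le_trans x1.
rewrite (_ : c%:E = \int[mu]_(x in `[1%R, 2%R]) (cst c x)%:E)%E; last first.
  have := @integral_cst _ _ R mu `[1%R, 2%R]%classic (measurable_itv _) c%:E.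
  move=> /= ->; rewrite lebesgue_measure_itv/= lte_fin ltr1n/= -EFinB -EFinM.
  by congr EFin; lra.
apply: ge0_le_integral => //.
- by move=> x _; rewrite lee_fin expR_ge0.
- exact/measurable_EFinP/measurable_cst.
- apply/measurable_EFinP; apply: measurable_funS mf => // x /=.
  rewrite !in_itv/= andbT => /andP[x1 _]; exact: lt_le_trans x1.
move=> x /=; rewrite in_itv/= => /andP[x1 x2]; have x0 : 0 < x
  by exact: lt_le_trans x1.
rewrite lee_fin /c /powR gt_eqF// -expRD ler_expR opprD lerD ?lerN2//.
rewrite lerNl -mulNr (le_trans (ler_norm _))// normrM normrN mulrC ler_wpM2r//.
rewrite ger0_norm ?ln_ge0// (le_trans (ltW (ln_sublinear x0)))//.
Qed.

Lemma Gamma1 : euler_gamma 1 = 1 :> R.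
Proof.
rewrite euler_gamma.unlock; apply: has_integral_int0oo.
apply: (@eq_has_integral0y (fun t => expR (- t))).
  by move=> x x0; rewrite subrr powRr0 mul1r.
pose F t := - expR (- t).
apply: (ge0_FTC2_exhaustion exhaustion0y (F := F)) => [x _|x _|x _|].
- apply: (@continuous_comp _ _ _ -%R expR); last exact: continuous_expR.
  exact: continuousN.
- exact: expR_ge0.
- by rewrite /F; apply: is_derive_eq; rewrite mulrN1 opprK.
rewrite -[X in _ --> X]add0r -[X in _ + X](opprK 1).
apply: cvg_exhaustion0y.
  rewrite /F -expR0 -{2}oppr0; apply: cvgN; apply: cvg_at_right_filter.
  apply: (@continuous_comp _ _ _ -%R expR); last exact: continuous_expR.
  exact: continuousN.
by rewrite -oppr0; apply: cvgN; exact: cvgr_expR.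
Qed.

Lemma powR_expR_cvg0 a : 0 < a -> t `^ a * expR (- t) @[t --> +oo] --> (0 : R).
Proof.
move=> a0; pose K : R := (a + 1) `^ (a + 1) * expR 1.
apply: (@squeeze_cvgr _ _ _ _ (cst 0) (fun t => K * t^-1)).
- near=> t; have t0 : 0 < t by near: t; exact: nbhs_pinfty_gt.
  have t1 : 0 < 1 + t by rewrite addr_gt0.
  rewrite mulr_ge0 ?powR_ge0 ?expR_ge0//= ler_pdivlMr//.
  apply: le_trans (powR_expR_le (ltW a0) (ltW t0)).
  rewrite -mulrA mulrCA ler_wpM2l ?expR_ge0//.
  rewrite -{2}(powRr1 (ltW t0)) -gt0_powRD//.
  by apply: ge0_ler_powR; rewrite ?nnegrE ?addr_ge0 ?ltW// ltrDr.
- exact: cvg_cst.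
- rewrite -(mulr0 K); apply: cvgMl_tmp.
  by apply/gtr0_cvgV0; [exact: nbhs_pinfty_gt|exact: cvg_id].
Unshelve. all: by end_near. Qed.

(** Integration by parts: -t^a exp(-t) is a primitive of the difference of the two integrands and
    vanishes at 0 and at infinity. *)
Lemma GammaD1 a : 0 < a -> euler_gamma (a + 1) = a * euler_gamma a.
Proof.
move=> a0; have a1 : 0 < a + 1 by rewrite addr_gt0.
pose F t := - (t `^ a * expR (- t)).
pose f t := t `^ (a + 1 - 1) * expR (- t) - a * (t `^ (a - 1) * expR (- t)).
have fi : has_integral `]0, +oo[ f (euler_gamma (a + 1) - a * euler_gamma a).
  apply: has_integralB => //; first exact: has_integral_Gamma.
  by apply: has_integralZl => //; exact: has_integral_Gamma.
apply/eqP; rewrite -subr_eq0; apply/eqP.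
apply: (FTC2_exhaustion exhaustion0y (F := F) _ _ _ fi) => [t|t|] /=.
- rewrite in_itv/= andbT => t0.
  apply: continuousB; first exact: continuous_powR_expRN.
  by apply: continuousM; [exact: cvg_cst|exact: continuous_powR_expRN].
- rewrite in_itv/= andbT => t0.
  have dp := is_derive1_powR a t0.
  apply: trigger_derive; rewrite /f addrK /GRing.scale/=; ring.
- rewrite -[X in _ --> X](subrr (- (0 : R))); apply: cvg_exhaustion0y.
    rewrite /F -[X in - X](mul0r (expR (- 0))).
    apply: cvgN; apply: cvgM; first exact: powR_cvg0.
    apply: cvg_at_right_filter.
    apply: (@continuous_comp _ _ _ -%R expR); last exact: continuous_expR.
    exact: continuousN.
  by apply: cvgN; exact: powR_expR_cvg0.
Qed.

Lemma has_integral_powR_expR a c : 0 < a -> 0 < c ->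
  has_integral `]0, +oo[ (fun t => t `^ (a - 1) * expR (- (c * t)))
    (euler_gamma a / c `^ a).
Proof.
move=> a0 c0; pose g t := t / c.
apply: (@substitution_exhaustion _ _ _ _ _ g (cst c^-1) _ _ (exhaustion0y (R := R))).
- apply: exhaustion_itv0y => [n|n|m n mn|m n mn||]; rewrite /g/=.
  + by rewrite divr_gt0 ?invr_gt0.
  + by rewrite ltr_pM2r ?invr_gt0//; have [+ _ _ _] := @exhaustion0y R; exact.
  + by rewrite ler_pM2r ?invr_gt0//; have [_ + _ _] := @exhaustion0y R; exact.
  + by rewrite ler_pM2r ?invr_gt0//; have [_ _ + _] := @exhaustion0y R; exact.
  + by rewrite -[X in _ --> X](mul0r c^-1); apply: cvgMr_tmp; exact: cvg_invn2.
  + have c1 : 0 < c^-1 by rewrite invr_gt0.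
    exact: (cvg_comp _ _ (@cvg_n2 R) (gt0_cvgMly c1 (@cvg_id _ _))).
- by move=> x y _ _ xy; rewrite /g ltr_pM2r ?invr_gt0.
- by move=> x _; exact: cvg_cst.
- by move=> x _; apply: trigger_derive; rewrite /GRing.scale/=; ring.
- by move=> x /=; rewrite in_itv/= andbT => x0; exact: continuous_powRM_expRN.
- by move=> x _; rewrite mulr_ge0 ?powR_ge0 ?expR_ge0.
- by move=> x _; rewrite invr_ge0 ltW.
have Gi := has_integralZl (c `^ a)^-1 (measurable_itv _) (has_integral_Gamma a0).
rewrite mulrC; apply: eq_has_integral0y Gi => x x0 /=.
rewrite /g (mulrCA c) mulfV ?gt_eqF// mulr1 !gt0_powRD ?divr_gt0//.
rewrite powRM ?invr_ge0 ?ltW// !powRN !powRr1 ?divr_ge0 ?ltW//.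
rewrite -[c^-1]powR_inv1 ?ltW// -powRrM mulN1r powRN.
rewrite powR_inv1 ?ltW//; have ca := powR_gt0 a c0; field.
by rewrite !gt_eqF.
Qed.

(** The substitution t = x^2 turns t^(-1/2) exp(-t) dt into 2 exp(-x^2) dx, a Gaussian integral. *)
Lemma Gamma_half : euler_gamma (2^-1) = Num.sqrt pi :> R.
Proof.
pose g t : R := t ^+ 2.
rewrite euler_gamma.unlock; apply: has_integral_int0oo.
apply: (@substitution_exhaustion _ _ _ _ _ g (fun t => 2 * t) _ _ (exhaustion0y (R := R))).
- have [ab da ub _] := @exhaustion0y R.
  have sq (x y : R) : 0 < x -> x <= y -> x ^+ 2 <= y ^+ 2.
    by move=> x0 xy; rewrite lerXn2r// nnegrE ltW// (lt_le_trans x0).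
  apply: exhaustion_itv0y => [n|n|m n mn|m n mn||]; rewrite /g/=.
  + by rewrite exprn_gt0 ?invr_gt0.
  + by rewrite ltrXn2r// nnegrE ?invr_ge0.
  + by apply: sq => //; exact: da.
  + by apply: sq => //; exact: ub.
  + rewrite -[X in _ --> X](mulr0 0); under eq_fun do rewrite expr2.
    by apply: cvgM; exact: cvg_invn2.
  + apply: (@ger_cvgy _ _ _ _ _ _ _ (@cvg_n2 R)); apply: nearW => n.
    by rewrite expr2 ler_peMr// ler1n.
- by move=> x y /=; rewrite !in_itv/= !andbT => x0 y0 xy;
    rewrite /g ltrXn2r ?ltW.
- by move=> x _; apply: continuousM => //; exact: cvg_cst.
- by move=> x _; apply: trigger_derive; rewrite /GRing.scale/=; ring.
- by move=> x /=; rewrite in_itv/= andbT; exact: continuous_powR_expRN.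
- by move=> x _; rewrite mulr_ge0 ?powR_ge0 ?expR_ge0.
- by move=> x /=; rewrite in_itv/= andbT => x0; rewrite mulr_ge0// ltW.
apply: (@eq_has_integral0y (fun t => 2 * gauss_fun t)).
  move=> x x0; rewrite /gauss_fun /g -powR_mulrn ?ltW// -powRrM.
  rewrite (_ : 2 * (2^-1 - 1) = -1); last by lra.
  by rewrite powRN powRr1 ?ltW//; field; rewrite gt_eqF.
rewrite (_ : Num.sqrt pi = 2 * (Num.sqrt pi / 2)); last by lra.
apply: has_integralZl => //; apply: ge0_has_integral => //.
- apply: measurable_funS (@measurable_gauss_fun R) => //.
- by move=> x _; exact: gauss_fun_ge0.
- rewrite integral_itv_obnd_cbnd ?integral0y_gauss//.
  by apply/measurable_EFinP; apply: measurable_funS (@measurable_gauss_fun R).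
Qed.

End Gamma.

(** * Bessel-Clifford functions *)


HB.lock Definition bc_coeff {R : realType} (b : R) (k : nat) : R :=
  (k`!%:R * euler_gamma (b + k%:R))^-1.

(* In the usual indexing this is the Bessel-Clifford function C_(b-1). *)
HB.lock Definition bessel_clifford {R : realType} (b w : R) : R :=
  limn (pseries (bc_coeff b) w).

Section bessel_clifford.
Context {R : realType}.
Notation mu := (@lebesgue_measure R).
Implicit Types (b c u v w x : R).

(** Beyond b + 1 each factor of the recurrence is at least 1. The start is b + 1 because Gamma
    decreases near 0, which is why [bc_coeff_le] adds two reciprocals: one for k = 0, one for k >=
    1. *)
Lemma Gamma_addn_ge b k : 0 < b ->
  euler_gamma (b + 1) <= euler_gamma (b + 1 + k%:R).
Proof.
move=> b0; elim: k => [|k IH]; first by rewrite addr0.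
have bk : 0 < b + 1 + k%:R by rewrite ltr_wpDr// addr_gt0.
rewrite -natr1 addrA (GammaD1 bk) (le_trans IH)// ler_peMl ?ltW ?Gamma_gt0//.
by rewrite addrAC ltrDr ltr_wpDr.
Qed.

Lemma bc_coeff_ge0 b k : 0 < b -> 0 <= bc_coeff b k.
Proof.
by move=> b0; rewrite bc_coeff.unlock invr_ge0 mulr_ge0// ltW// Gamma_gt0// ltr_wpDr.
Qed.

Lemma bc_coeff_le b k : 0 < b ->
  bc_coeff b k <= ((euler_gamma b)^-1 + (euler_gamma (b + 1))^-1) * k`!%:R^-1.
Proof.
move=> b0; rewrite bc_coeff.unlock invfM mulrC ler_wpM2r ?invr_ge0//.
have G0 : 0 < euler_gamma b by exact: Gamma_gt0.
have G1 : 0 < euler_gamma (b + 1) by rewrite Gamma_gt0// addr_gt0.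
case: k => [|k]; first by rewrite addr0 lerDl invr_ge0 ltW.
have bk := Gamma_addn_ge k b0.
rewrite -nat1r addrA (@le_trans _ _ (euler_gamma (b + 1))^-1)//.
  by rewrite lef_pV2 ?posrE// (lt_le_trans G1).
by rewrite lerDr invr_ge0 ltW.
Qed.

Lemma cvg_series_scale (u_ : R^nat) l c :
  series u_ @ \oo --> l -> series (fun k => c * u_ k) @ \oo --> c * l.
Proof.
move=> ul; rewrite (_ : series _ = (fun n => c * series u_ n)).
  exact: cvgMl_tmp.
by apply/funext => n; rewrite /series/= mulr_sumr.
Qed.

Lemma is_cvg_bessel_clifford b w : 0 < b -> cvgn (pseries (bc_coeff b) w).
Proof.
move=> b0; pose M : R := (euler_gamma b)^-1 + (euler_gamma (b + 1))^-1.
have M0 : 0 <= M by rewrite addr_ge0// invr_ge0 ltW// Gamma_gt0// addr_gt0.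
apply: normed_cvg => /=.
apply: (@series_le_cvg _ _ (fun k => M * exp_coeff `|w| k)).
- by move=> n /=; exact: normr_ge0.
- by move=> n; rewrite mulr_ge0// exp_coeff_ge0.
- move=> n /=; rewrite normrM normrX ger0_norm ?bc_coeff_ge0//.
  rewrite exp_coeffE mulrA ler_wpM2r ?exprn_ge0//; exact: bc_coeff_le.
- exact/cvgP/cvg_series_scale/is_cvg_series_exp_coeff.
Qed.

Lemma cvg_bessel_clifford b w : 0 < b ->
  series (fun k => bc_coeff b k * w ^+ k) @ \oo --> bessel_clifford b w.
Proof. by move=> b0; rewrite bessel_clifford.unlock;
  exact: is_cvg_bessel_clifford. Qed.

Lemma bc_coeff_diffs b : pseries_diffs (bc_coeff b) = bc_coeff (b + 1).
Proof.
apply/funext => k; rewrite /pseries_diffs bc_coeff.unlock factS natrM -addrA nat1r.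
by rewrite -mulrA invfM mulrA divff// mul1r.
Qed.

Lemma is_derive_bessel_clifford b w : 0 < b ->
  is_derive w 1 (bessel_clifford b) (bessel_clifford (b + 1) w).
Proof.
move=> b0; have b1 : 0 < b + 1 by rewrite addr_gt0.
rewrite bessel_clifford.unlock -bc_coeff_diffs;
  apply: (@pseries_snd_diffs _ _ (`|w| + 1)).
- exact: is_cvg_bessel_clifford.
- by rewrite bc_coeff_diffs; exact: is_cvg_bessel_clifford.
- by rewrite !bc_coeff_diffs; apply: is_cvg_bessel_clifford; rewrite addr_gt0.
- by rewrite [ltRHS]ger0_norm ?addr_ge0// ltrDl.
Qed.

(* Bessel's differential equation, read off the coefficients. *)
Lemma bessel_clifford_rec b w : 0 < b ->
  bessel_clifford b w =
    b * bessel_clifford (b + 1) w + w * bessel_clifford (b + 2) w.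
Proof.
move=> b0; have b1 : 0 < b + 1 by rewrite addr_gt0.
have b2 : 0 < b + 2 by rewrite addr_gt0.
pose s c := series (fun k => bc_coeff c k * w ^+ k).
(* The factor w raises the degree by one, so the partial sum of index b + 2 lags one term behind. *)
have sS n : s b n.+1 = b * s (b + 1) n.+1 + w * s (b + 2) n.
  elim: n => [|n IH].
    rewrite /s /series/= !big_nat1 big_nil mulr0 addr0 !expr0 !mulr1.
    rewrite bc_coeff.unlock fact0 !mul1r !addr0 GammaD1// invfM mulrA divff ?gt_eqF//.
    by rewrite mul1r.
  have sr c m : s c m.+1 = s c m + bc_coeff c m * w ^+ m.
    by rewrite /s /series/= big_nat_recr.
  rewrite sr IH (sr (b + 1) n.+1) (sr (b + 2) n).
  suff -> : bc_coeff b n.+1 = b * bc_coeff (b + 1) n.+1 + bc_coeff (b + 2) n.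
    by rewrite exprS; ring.
  have bn : 0 < b + n.+1%:R by rewrite addr_gt0.
  rewrite bc_coeff.unlock -(addrAC b _ 1) GammaD1//.
  have -> : b + 2 + n%:R = b + n.+1%:R + 1 by rewrite -natr1; ring.
  rewrite GammaD1// factS natrM.
  have G0 := Gamma_gt0 bn; have f0 : (n`!%:R : R) != 0
    by rewrite pnatr_eq0 -lt0n fact_gt0.
  have n0 : (n.+1%:R : R) != 0 by [].
  have N : (n.+1%:R : R) + b != 0 by rewrite addrC gt_eqF.
  move: G0 f0 n0 N; move: (euler_gamma (b + n.+1%:R)) (n`!%:R) (n.+1%:R) => G f m G0 f0 m0 mb.
  have mb' : b + m != 0 by rewrite addrC.
  by field; rewrite f0 m0 mb' gt_eqF.
have cs c : 0 < c -> s c @ \oo --> bessel_clifford c w.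
  exact: cvg_bessel_clifford.
apply: (@cvg_unique _ (@Rhausdorff R) (s b n.+1 @[n --> \oo])).
  by have := cs _ b0; rewrite -cvg_shiftS.
rewrite (_ : (fun n => _) = (fun n => b * s (b + 1) n.+1 + w * s (b + 2) n));
  last exact/funext.
apply: cvgD; apply: cvgMl_tmp; last exact: cs.
by have := cs _ b1; rewrite -cvg_shiftS.
Qed.

(** The k-th term integrates to a multiple of Gamma(b + k), which cancels the one in [bc_coeff] and
    leaves the exponential series of v/c. *)
Lemma has_integral_bessel_clifford b c v : 0 < b -> 0 < c -> 0 <= v ->
  has_integral `]0, +oo[
    (fun u => u `^ (b - 1) * expR (- (c * u)) * bessel_clifford b (u * v))
    (expR (v / c) / c `^ b).
Proof.
move=> b0 c0 v0.
pose f_ k u := bc_coeff b k * v ^+ k * (u `^ (b + k%:R - 1) * expR (- (c * u))).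
pose v_ k := bc_coeff b k * v ^+ k * (euler_gamma (b + k%:R) / c `^ (b + k%:R)).
have bk k : 0 < b + k%:R by rewrite ltr_wpDr.
apply: (@has_integral_series _ _ f_ v_) => //.
- move=> k x _; rewrite mulr_ge0 ?mulr_ge0 ?powR_ge0 ?expR_ge0 ?exprn_ge0//.
  exact: bc_coeff_ge0.
- move=> k; exact: (has_integralZl (bc_coeff b k * v ^+ k) (measurable_itv _)
    (has_integral_powR_expR (bk k) c0)).
- rewrite (_ : v_ = (fun k => (c `^ b)^-1 * exp_coeff (v / c) k)).
    by rewrite (mulrC (expR _));
      exact: cvg_series_scale (is_cvg_series_exp_coeff _).
  apply/funext => k; rewrite /v_ bc_coeff.unlock exp_coeffE gt0_powRD// powR_mulrn ?ltW//.
  rewrite exprMn exprVn.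
  have G0 := Gamma_gt0 (bk k); have f0 : (k`!%:R : R) != 0
    by rewrite pnatr_eq0 -lt0n fact_gt0.
  have cb := powR_gt0 b c0; have ck : 0 < c ^+ k by rewrite exprn_gt0.
  by field; rewrite f0 !gt_eqF.
- move=> u /=; rewrite in_itv/= andbT => u0.
  rewrite (_ : series _ = (fun n => u `^ (b - 1) * expR (- (c * u)) *
      series (fun k => bc_coeff b k * (u * v) ^+ k) n)).
    by apply: cvgMl_tmp; exact: cvg_bessel_clifford.
  apply/funext => n; rewrite /series/= mulr_sumr; apply: eq_bigr => k _.
  rewrite /f_ exprMn (addrAC b) (gt0_powRD _ k%:R u0) powR_mulrn ?ltW//; ring.
Qed.

(** The weight is one power too high for the index b. The recurrence E_b = b E_(b+1) + uv E_(b+2)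
    splits the integrand into u^b E_(b+1) and u^(b+1) E_(b+2), both correctly matched. *)
Lemma has_integral_bessel_clifford_shift b c v : 0 < b -> 0 < c -> 0 <= v ->
  has_integral `]0, +oo[
    (fun u => u `^ b * expR (- (c * u)) * bessel_clifford b (u * v))
    ((b / c `^ (b + 1) + v / c `^ (b + 2)) * expR (v / c)).
Proof.
move=> b0 c0 v0; have b1 : 0 < b + 1 by rewrite addr_gt0.
have b2 : 0 < b + 2 by rewrite addr_gt0.
have h1 := has_integralZl b (measurable_itv _) (has_integral_bessel_clifford b1 c0 v0).
have h2 := has_integralZl v (measurable_itv _) (has_integral_bessel_clifford b2 c0 v0).
rewrite (_ : _ * expR _ = b * (expR (v / c) / c `^ (b + 1)) +
  v * (expR (v / c) / c `^ (b + 2))); last by ring.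
apply: eq_has_integral0y (has_integralD (measurable_itv _) h1 h2) => u u0.
rewrite [in RHS]bessel_clifford_rec// addrK.
have -> : b + 2 - 1 = b + 1 by ring.
by rewrite gt0_powRD// powRr1 ?ltW//; ring.
Qed.

(** A case of Legendre's duplication formula: k! Gamma(k + 1/2) = sqrt(pi) (2k)! / 4^k. *)
Lemma bc_coeff_half k :
  Num.sqrt pi * bc_coeff (2^-1) k = 4 ^+ k / (k.*2)`!%:R :> R.
Proof.
have h0 : (0 : R) < 2^-1 by rewrite invr_gt0.
have pi0 : (0 : R) < Num.sqrt pi by rewrite sqrtr_gt0 pi_gt0.
elim: k => [|k IH].
  by rewrite bc_coeff.unlock addr0 Gamma_half fact0 !mul1r mulfV ?gt_eqF// invr1.
have -> : bc_coeff (2^-1) k.+1 =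
    bc_coeff (2^-1) k / (k.+1%:R * (2^-1 + k%:R)) :> R.
  have kh : (0 : R) < 2^-1 + k%:R by rewrite ltr_wpDr.
  rewrite bc_coeff.unlock factS natrM.
  rewrite (_ : 2^-1 + k.+1%:R = 2^-1 + k%:R + 1); last by rewrite -addrA natr1.
  rewrite (GammaD1 kh).
  by rewrite -invfM; congr (_^-1); ring.
rewrite mulrA IH doubleS !factS !natrM exprS -!natr1 -mul2n natrM.
have f0 : ((2 * k)`!%:R : R) != 0 by rewrite pnatr_eq0 -lt0n fact_gt0.
have k0 : 0 <= (k%:R : R) by [].
move: (k%:R) ((2 * k)`!%:R) k0 f0 => m f m0 f0.
by field; rewrite f0 /= !gt_eqF//; lra.
Qed.

(** By the duplication formula, E_(1/2)(x^2) is cosh(2x) / sqrt(pi). This is the whole of [phi] when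
    d = 1 and the even part of the exponential when d >= 2. *)
Lemma expR2D_bessel_clifford x :
  expR (2 * x) + expR (- (2 * x)) =
    2 * Num.sqrt pi * bessel_clifford (2^-1) (x ^+ 2).
Proof.
have h0 : (0 : R) < 2^-1 by rewrite invr_gt0.
pose e := series (exp_coeff (2 * x)); pose e' := series (exp_coeff (- (2 * x))).
pose s := series (fun k => bc_coeff (2^-1) k * (x ^+ 2) ^+ k).
(* Odd terms cancel in e + e', so 2n terms of the exponential series correspond to n terms of s; the
   limit is taken along the even indices. *)
have esE n : e n.*2 + e' n.*2 = 2 * Num.sqrt pi * s n.
  elim: n => [|n IH]; first by rewrite /e /e' /s /series/= !big_nil addr0 mulr0.
  have sr (u : R^nat) m : series u m.+1 = series u m + u m.
    by rewrite /series/= big_nat_recr.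
  rewrite doubleS /e /e' /s !sr mulrDr -IH -/e -/e'.
  have -> y : 2 * Num.sqrt pi * (bc_coeff (2^-1) n * y) =
    2 * (Num.sqrt pi * bc_coeff (2^-1) n) * y by ring.
  rewrite bc_coeff_half.
  rewrite !exp_coeffE exprS [(- _) ^+ _.+1]exprS [(- (2 * x)) ^+ _]exprNn -signr_odd odd_double expr0.
  have -> : (4 : R) ^+ n = 2 ^+ n.*2
    by rewrite -mul2n exprM; congr (_ ^+ _); ring.
  rewrite -exprM mul2n !exprMn.
  by ring.
have dbl : n.*2 @[n --> \oo] --> \oo.
  move=> A [N _ NA]; exists N => // n /= Nn; apply: NA => /=.
  by rewrite -addnn (leq_trans Nn)// leq_addr.
apply: (@cvg_unique _ (@Rhausdorff R) (e n.*2 + e' n.*2 @[n --> \oo])).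
  apply: cvgD; first exact: (cvg_comp _ _ dbl (is_cvg_series_exp_coeff (2 * x))).
  exact: (cvg_comp _ _ dbl (is_cvg_series_exp_coeff (- (2 * x)))).
rewrite (_ : (fun n => _) = (fun n => 2 * Num.sqrt pi * s n));
  last exact/funext.
by apply: cvgMl_tmp; exact: cvg_bessel_clifford.
Qed.

End bessel_clifford.

(** * Moments of the symmetric beta weight *)


Section beta_moments.
Context {R : realType}.
Notation mu := (@lebesgue_measure R).
Notation I11 := (`](-1), 1[%classic : set (measurableTypeR R)).
Implicit Types (a b c x z p t u v : R).

Lemma cvg_exhaustionN11 (F : R -> R) l0 l1 :
  F x @[x --> (-1)^'+] --> l0 -> F x @[x --> 1^'-] --> l1 ->
  F (1 - n.+2%:R^-1) - F (- (1 - n.+2%:R^-1)) @[n --> \oo] --> l1 - l0.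
Proof.
have c1 : 1 - n.+2%:R^-1 @[n --> \oo] --> (1 : R).
  by rewrite -[X in _ --> X]subr0; apply: cvgB;
    [exact: cvg_cst|exact: cvg_invn2].
move=> /cvg_at_rightP F0 /cvg_at_leftP F1; apply: cvgB.
  by apply: F1; split => // n; rewrite ltrBlDr ltrDl invr_gt0.
by apply: F0; split => [n|]; [rewrite ltrN2 ltrBlDr ltrDl invr_gt0|exact: cvgN].
Qed.

Lemma has_integralN11_oppr (f : R -> R) v :
  (forall t, I11 t -> 0 <= f t) ->
  has_integral I11 f v -> has_integral I11 (fun t => f (- t)) v.
Proof.
move=> f0 fv; have mf := has_integral_measurable fv.
have NE : (-%R : _ -> measurableTypeR R) @^-1` I11 = I11.
  by rewrite opp_preimage_itvbndbnd/= opprK.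
have mopp : measurable_fun setT (-%R : measurableTypeR R -> measurableTypeR R).
  exact: (@oppr_measurable R setT).
have mfN : measurable_fun I11 (fun t => f (- t)).
  apply: (@measurable_comp _ _ _ (measurableTypeR R) (measurableTypeR R) R I11 f
    I11 (-%R)) => //.
  by move=> _ [t /= t1 <-]; move: t1; rewrite !in_itv/= ltrN2 ltrNl andbC.
apply: ge0_has_integral => //.
  move=> t /=; rewrite in_itv/= => t1; apply: f0 => /=.
  by rewrite in_itv/= ltrN2 ltrNl andbC.
rewrite -(has_integralE (measurable_itv _) fv) -[in LHS]NE.
rewrite -(@ge0_integral_pushforward _ _ _ _ R _ mopp mu _ (EFin \o f))//.
- by apply: eq_measure_integral => //= A mA _; exact: lebesgue_measureN.
- exact/measurable_EFinP.
- by move=> t /set_mem t1; rewrite lee_fin f0.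
Qed.

(** The derivative of asin exists only inside (-1, 1); the end values come from continuity of the
    inverse of sin on a closed segment. *)
Lemma cvg_asin : @asin R x @[x --> (-1)^'+] --> - (pi / 2) /\
  @asin R x @[x --> 1^'-] --> pi / 2.
Proof.
have pi0 : 0 < pi :> R := pi_gt0 R.
have ppi : - (pi / 2) <= pi / 2 :> R by lra.
have csin : {within `[- (pi / 2), pi / 2], continuous (@sin R)}.
  exact/continuous_subspaceT/continuous_sin.
have := segment_can_continuous ppi csin (@sinK R).
rewrite sinN sin_pihalf (@min_l _ _ (-1)) ?(@max_r _ _ (-1)); [|lra..].
move=> /continuous_within_itvP[]; first by lra.
have asinE x : - (pi / 2) <= x <= pi / 2 -> asin (sin x) = x.
  by move=> xI; rewrite sinK// in_itv.
have := asinE (- (pi / 2)); rewrite sinN sin_pihalf lexx ppi => -> //.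
have := asinE (pi / 2); rewrite sin_pihalf lexx ppi => -> //.
Qed.

Lemma is_derive_exprS n t :
  is_derive t 1 (fun t : R => t ^+ n.+1) (n.+1%:R * t ^+ n).
Proof.
have := is_deriveX n.+1 (is_derive_id t (1 : R)).
by rewrite exprfctE /GRing.scale/= mulr1.
Qed.

Lemma subr_sqr_gt0 t : I11 t -> 0 < 1 - t ^+ 2.
Proof.
rewrite /= in_itv/= => /andP[t1 t2]; rewrite (_ : _ - _ = (1 - t) * (1 + t));
  last by ring.
by rewrite mulr_gt0//; lra.
Qed.

Lemma continuous_subr_sqr_powR p t : I11 t ->
  {for t, continuous (fun t => (1 - t ^+ 2) `^ p)}.
Proof.
move=> t1; apply: (@continuous_comp _ _ _ (fun t => 1 - t ^+ 2) (@powR R ^~ p)).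
  by apply: continuousB; [exact: cvg_cst|exact: exprn_continuous].
exact/continuous_powR_gt0/subr_sqr_gt0.
Qed.

Definition beta_weight (k : nat) p t := t ^+ k.*2 * (1 - t ^+ 2) `^ p.

Lemma continuous_beta_weight k p t : I11 t ->
  {for t, continuous (beta_weight k p)}.
Proof.
move=> t1; apply: continuousM; last exact: continuous_subr_sqr_powR.
exact: exprn_continuous.
Qed.

Lemma beta_weight_ge0 k p t : 0 <= beta_weight k p t.
Proof. by rewrite mulr_ge0 ?powR_ge0// -muln2 exprM sqr_ge0. Qed.

Lemma measurable_beta_weight k p : measurable_fun I11 (beta_weight k p).
Proof.
by apply: (exhaustion_measurable_fun exhaustionN11) => t;
  exact: continuous_beta_weight.
Qed.

(** With s = t^2 the moment is Euler's Beta function B(k + 1/2, x). All k are taken together because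
    raising x by 1 involves the moment k + 1. *)
Definition beta_moment_at x := forall k, has_integral I11
  (beta_weight k (x - 1))
  (euler_gamma (2^-1 + k%:R) * euler_gamma x / euler_gamma (2^-1 + k%:R + x)).

Let half_gt0 : (0 : R) < 2^-1. Proof. by rewrite invr_gt0. Qed.
Let kh_gt0 k : (0 : R) < 2^-1 + k%:R. Proof. by rewrite ltr_wpDr. Qed.

Lemma has_integral_asin :
  has_integral I11 (beta_weight 0 (2^-1 - 1)) pi.
Proof.
apply: (ge0_FTC2_exhaustion exhaustionN11 (F := asin)) => [t|t|t t1|].
- exact: continuous_beta_weight.
- by move=> _; exact: beta_weight_ge0.
- have t0 := subr_sqr_gt0 t1.
  have tI : -1 < t < 1 by move: t1; rewrite /= in_itv.
  apply: (is_derive_eq (is_derive1_asin tI)).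
  rewrite /beta_weight expr0 mul1r -powR12_sqrt ?ltW// -powRN.
  by congr powR; lra.
- rewrite (_ : pi = pi / 2 - - (pi / 2)); last by lra.
  by have [? ?] := cvg_asin; exact: cvg_exhaustionN11.
Qed.

Lemma has_integral_beta_weight_half k : has_integral I11
  (beta_weight k (2^-1 - 1)) (\int[mu]_(t in `](-1), 1[) beta_weight k (2^-1 - 1) t).
Proof.
apply: (le_has_integral _ _ _ has_integral_asin) => //.
  exact: measurable_beta_weight.
move=> t t1; rewrite ger0_norm ?beta_weight_ge0// /beta_weight expr0.
rewrite ler_wpM2r ?powR_ge0// -mul2n exprM exprn_ile1 ?sqr_ge0//.
by rewrite -subr_ge0 ltW ?subr_sqr_gt0.
Qed.

Lemma beta_moment_half : beta_moment_at 2^-1.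
Proof.
elim=> [|k IH].
  rewrite addr0 Gamma_half; have -> : 2^-1 + 2^-1 = 1 :> R by lra.
  by rewrite Gamma1 divr1 -expr2 sqr_sqrtr ?pi_ge0//; exact: has_integral_asin.
have fi := has_integral_beta_weight_half k.+1.
set v := Rintegral _ _ _ in fi.
suff vE : (2 * k%:R + 2) * v = (2 * k%:R + 1) *
    (euler_gamma (2^-1 + k%:R) * euler_gamma (2^-1) / euler_gamma (2^-1 + k%:R + 2^-1)).
  rewrite (_ : euler_gamma _ * _ / _ = v)//.
  have k0 : 0 <= (k%:R : R) by [].
  have k1 : (0 : R) < 2 * k%:R + 2 by lra.
  apply: (@mulfI _ (2 * k%:R + 2)); rewrite ?gt_eqF// vE.
  have -> : 2^-1 + k.+1%:R = 2^-1 + k%:R + 1 :> R by rewrite -addrA natr1.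
  rewrite (GammaD1 (kh_gt0 k)) (addrAC _ 1) GammaD1; last by rewrite addr_gt0.
  have G0 := Gamma_gt0 (kh_gt0 k).
  have kk : 0 < 2^-1 + k%:R + 2^-1 :> R by rewrite addr_gt0.
  have G1 := Gamma_gt0 kk.
  move: (euler_gamma (2^-1 + k%:R)) (euler_gamma (2^-1)) G0 => x y x0.
  move: (euler_gamma (2^-1 + k%:R + 2^-1)) G1 kk => w w0.
  move: (k%:R) k0 k1 => m m0 m1 mm.
  field; rewrite !gt_eqF//; lra.
have mI : measurable I11 by exact: measurable_itv.
have gi := has_integralB mI (has_integralZl (2 * k%:R + 1) mI IH)
  (has_integralZl (2 * k%:R + 2) mI fi).
(* F vanishes at both ends, so the integral of F' = (2k+1) f_k - (2k+2) f_(k+1)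
   is 0. *)
pose F t := t ^+ k.*2.+1 * (1 - t ^+ 2) `^ 2^-1.
apply/eqP; rewrite eq_sym -subr_eq0; apply/eqP.
apply: (FTC2_exhaustion exhaustionN11 (F := F) _ _ _ gi) => [t t1|t t1|].
- by apply: continuousB; apply: continuousM; (try exact: cvg_cst);
    exact: continuous_beta_weight.
- have t0 := subr_sqr_gt0 t1.
  have d0 : is_derive t 1 (fun t : R => 1 - t ^+ 2) (- (2 * t)).
    by apply: trigger_derive; rewrite /GRing.scale/=; ring.
  have d1 := @is_derive1_comp R (@powR R ^~ 2^-1) _ t _ _ (is_derive1_powR 2^-1 t0) d0.
  have d2 := is_derive_exprS k.*2 t.
  apply: (is_derive_eq (is_deriveM d2 d1)).
  rewrite /comp /=.
  have -> : (1 - t ^+ 2) `^ 2^-1 = (1 - t ^+ 2) `^ (2^-1 - 1) * (1 - t ^+ 2).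
    by rewrite -{3}(powRr1 (ltW t0)) -gt0_powRD// subrK.
  rewrite /beta_weight /GRing.scale/= doubleS !exprS -(@natr1 _ k.*2) -mul2n natrM.
  by field.
(* F1 is F with a square root in place of the power 1/2: it is continuous on the whole line, so the
   boundary limits of F are its values at -1 and 1, both 0. *)
- pose F1 t := t ^+ k.*2.+1 * Num.sqrt (1 - t ^+ 2).
  have F1c : continuous F1.
    move=> t; apply: (@continuousM _ _ (fun t : R => t ^+ k.*2.+1)
      (fun t : R => Num.sqrt (1 - t ^+ 2))); first exact: exprn_continuous.
    apply: (@continuous_comp _ _ _ (fun t : R => 1 - t ^+ 2) Num.sqrt).
      by apply: continuousB; [exact: cvg_cst|exact: exprn_continuous].
    exact: sqrt_continuous.
  have F10 t : t ^+ 2 = 1 -> F1 t = 0.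
    by move=> t1; rewrite /F1 t1 subrr sqrtr0 mulr0.
  have FF1 t : -1 < t -> t < 1 -> F1 t = F t.
    move=> t1 t2; have t0 : 0 < 1 - t ^+ 2.
      by apply: subr_sqr_gt0; rewrite /= in_itv/= t1 t2.
    by rewrite /F1 /F -powR12_sqrt// ltW.
  rewrite -[X in _ --> X](subrr 0); apply: cvg_exhaustionN11.
    rewrite -(F10 (-1)); last by rewrite sqrrN expr1n.
    apply: cvg_trans (cvg_at_right_filter (F1c (-1))); apply: near_eq_cvg.
    by near=> t; apply: FF1; near: t;
      [exact: nbhs_right_gt|exact: nbhs_right_lt].
  rewrite -(F10 1); last by rewrite expr1n.
  apply: cvg_trans (cvg_at_left_filter (F1c 1)); apply: near_eq_cvg.
  by near=> t; apply: FF1; near: t; [exact: nbhs_left_gt|exact: nbhs_left_lt].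
Unshelve. all: by end_near. Qed.

Lemma beta_moment1 : beta_moment_at 1.
Proof.
move=> k; rewrite Gamma1 mulr1 (GammaD1 (kh_gt0 k)).
have G0 := Gamma_gt0 (kh_gt0 k).
pose F t := (2 * k%:R + 1)^-1 * t ^+ k.*2.+1.
have k1 : (0 : R) < 2 * k%:R + 1 by rewrite ltr_wpDl// mulr_ge0.
have -> : euler_gamma (2^-1 + k%:R) / ((2^-1 + k%:R) * euler_gamma (2^-1 + k%:R)) =
    F 1 - F (-1).
  rewrite /F -signr_odd /= odd_double expr1n expr1.
  move: (euler_gamma _) G0 => g g0; field; rewrite !gt_eqF//; lra.
set l := F 1 - F (-1).
apply: (@ge0_FTC2_exhaustion _ _ _ _ (beta_weight k (1 - 1)) F l exhaustionN11)
  => [t|t|t t1|].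
- exact: continuous_beta_weight.
- by move=> _; exact: beta_weight_ge0.
- have d2 := is_derive_exprS k.*2 t.
  apply: (is_derive_eq (is_deriveM (is_derive_cst _ _ _) d2)).
  rewrite /beta_weight subrr powRr0 mulr1 scaler0 addr0 /GRing.scale/=.
  by rewrite mulrA -(@natr1 _ k.*2) -mul2n natrM mulVf ?mul1r ?gt_eqF.
have FE : continuous F.
  move=> t; apply: (@continuousM _ _ (cst _) (fun t : R => t ^+ k.*2.+1)).
    exact: cvg_cst.
  exact: exprn_continuous.
apply: cvg_exhaustionN11; first exact/cvg_at_right_filter/FE.
exact/cvg_at_left_filter/FE.
Qed.

(** Since (1 - t^2)^x = (1 - t^2)^(x-1) - t^2 (1 - t^2)^(x-1), the new moment k is the old moment k
    minus the old moment k + 1. *)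
Lemma beta_momentD1 x : 0 < x -> beta_moment_at x -> beta_moment_at (x + 1).
Proof.
move=> x0 Hx k; have mI : measurable I11 by exact: measurable_itv.
have fi := has_integralB mI (Hx k) (Hx k.+1).
rewrite (_ : _ / _ = euler_gamma (2^-1 + k%:R) * euler_gamma x /
   euler_gamma (2^-1 + k%:R + x) - euler_gamma (2^-1 + k.+1%:R) * euler_gamma x /
   euler_gamma (2^-1 + k.+1%:R + x)).
  apply: (eq_has_integral mI _ fi) => t t1; have t0 := subr_sqr_gt0 t1.
  rewrite /beta_weight addrK.
  have -> : (1 - t ^+ 2) `^ x = (1 - t ^+ 2) `^ (x - 1) * (1 - t ^+ 2).
    by rewrite -{3}(powRr1 (ltW t0)) -gt0_powRD// subrK.
  by rewrite doubleS !exprS; ring.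
have -> : 2^-1 + k.+1%:R = 2^-1 + k%:R + 1 :> R by rewrite -addrA natr1.
have kx : 0 < 2^-1 + k%:R + x by rewrite addr_gt0.
rewrite (addrAC _ 1) (GammaD1 (kh_gt0 k)) addrA !GammaD1//.
have G0 := Gamma_gt0 (kh_gt0 k); have G1 := Gamma_gt0 kx.
move: (euler_gamma (2^-1 + k%:R)) G0 (euler_gamma (2^-1 + k%:R + x)) G1 => g g0 h h0.
move: (2^-1 + k%:R) kx => m mx.
by field; rewrite !gt_eqF.
Qed.

(** [phi] calls only for x = (d - 1)/2 with d >= 2, so the bases 1/2 and 1 and unit steps in x
    suffice. *)
Lemma beta_moment n : beta_moment_at (n.+1%:R / 2).
Proof.
elim/ltn_ind: n => -[|[|n]] IH.
- by rewrite mul1r; exact: beta_moment_half.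
- by rewrite divff//; exact: beta_moment1.
- have -> : n.+3%:R / 2 = n.+1%:R / 2 + 1 :> R.
    by rewrite -(@natr1 _ n.+2) -(@natr1 _ n.+1); field.
  by apply: beta_momentD1; [rewrite divr_gt0|exact: IH].
Qed.

End beta_moments.

(** * The von Mises-Fisher kernel on the sphere *)


Section vMF_kernel.
Context {R : realType}.
Notation mu := (@lebesgue_measure R).
Notation I11 := (`](-1), 1[%classic : set (measurableTypeR R)).
Implicit Types (d n k : nat) (r s u v z : R).

(** In each term the Beta moment trades Gamma(1/2 + k) for Gamma(1/2 + x + k), raising the index
    from 1/2 to 1/2 + x, which is d/2 for x = (d - 1)/2. *)
Lemma has_integral_beta_bessel n z : has_integral I11
  (fun t => (1 - t ^+ 2) `^ (n.+1%:R / 2 - 1) * bessel_clifford 2^-1 ((t * z) ^+ 2))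
  (euler_gamma (n.+1%:R / 2) * bessel_clifford (2^-1 + n.+1%:R / 2) (z ^+ 2)).
Proof.
set x := n.+1%:R / 2.
have x0 : 0 < x by rewrite divr_gt0.
have h0 : (0 : R) < 2^-1 by rewrite invr_gt0.
have hx : 0 < 2^-1 + x by rewrite addr_gt0.
have hk k : (0 : R) < 2^-1 + k%:R by rewrite ltr_wpDr.
pose f_ k t := bc_coeff 2^-1 k * (z ^+ 2) ^+ k * beta_weight k (x - 1) t.
pose v_ k := bc_coeff 2^-1 k * (z ^+ 2) ^+ k *
  (euler_gamma (2^-1 + k%:R) * euler_gamma x / euler_gamma (2^-1 + k%:R + x)).
apply: (@has_integral_series _ _ f_ v_) => //.
- move=> k t _; apply: mulr_ge0; last exact: beta_weight_ge0.
  by apply: mulr_ge0; [exact: bc_coeff_ge0|exact/exprn_ge0/sqr_ge0].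
- move=> k; exact: (has_integralZl (bc_coeff 2^-1 k * (z ^+ 2) ^+ k)
    (measurable_itv _) (beta_moment n k)).
- rewrite (_ : v_ = (fun k => euler_gamma x * (bc_coeff (2^-1 + x) k * (z ^+ 2) ^+ k))).
    by apply: cvg_series_scale; exact: cvg_bessel_clifford.
  apply/funext => k; rewrite /v_ bc_coeff.unlock (addrAC _ x).
  have G0 := Gamma_gt0 (hk k); have hkx : 0 < 2^-1 + k%:R + x
    by rewrite addr_gt0.
  have G1 := Gamma_gt0 hkx.
  have f0 : (k`!%:R : R) != 0 by rewrite pnatr_eq0 -lt0n fact_gt0.
  move: (euler_gamma (2^-1 + k%:R)) (euler_gamma (2^-1 + k%:R + x)) G0 G1 => a b a0 b0.
  by field; rewrite f0 !gt_eqF.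
- move=> t _.
  rewrite (_ : series _ = (fun m => (1 - t ^+ 2) `^ (x - 1) *
      series (fun k => bc_coeff 2^-1 k * ((t * z) ^+ 2) ^+ k) m)).
    by apply: cvgMl_tmp; exact: cvg_bessel_clifford.
  apply/funext => m; rewrite /series/= mulr_sumr; apply: eq_bigr => k _.
  rewrite /f_ /beta_weight -mul2n exprM [(t * z) ^+ 2]exprMn.
  by rewrite [(t ^+ 2 * z ^+ 2) ^+ k]exprMn; ring.
Qed.

(** Poisson's integral for Bessel functions. The symmetrised integrand f(t) + f(-t) is a hyperbolic
    cosine with known integral; it dominates f, and reflection gives both summands the same
    integral. *)
Lemma has_integral_beta_expR n z : has_integral I11
  (fun t => (1 - t ^+ 2) `^ (n.+1%:R / 2 - 1) * expR (2 * (t * z)))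
  (Num.sqrt pi * euler_gamma (n.+1%:R / 2) *
   bessel_clifford (2^-1 + n.+1%:R / 2) (z ^+ 2)).
Proof.
have mI : measurable I11 by exact: measurable_itv.
pose f t := (1 - t ^+ 2) `^ (n.+1%:R / 2 - 1) * expR (2 * (t * z)).
have hb := has_integralZl (2 * Num.sqrt pi) mI (has_integral_beta_bessel n z).
have f0 t : 0 <= f t by rewrite mulr_ge0 ?powR_ge0 ?expR_ge0.
have sf : has_integral I11 (fun t => f t + f (- t)) (2 * Num.sqrt pi *
    (euler_gamma (n.+1%:R / 2) * bessel_clifford (2^-1 + n.+1%:R / 2) (z ^+ 2))).
  apply: (eq_has_integral mI _ hb) => t _.
  rewrite /f sqrrN mulNr mulrN -mulrDr expR2D_bessel_clifford; ring.
have mf : measurable_fun I11 f.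
  apply: (exhaustion_measurable_fun exhaustionN11) => t t1.
  apply: continuousM; first exact: continuous_subr_sqr_powR.
  apply: (@continuous_comp _ _ _ (fun t : R => 2 * (t * z)) expR).
    apply: continuousM; first exact: cvg_cst.
    by apply: continuousM => //; exact: cvg_cst.
  exact: continuous_expR.
have fi : has_integral I11 f (\int[mu]_(t in I11) f t).
  apply: (le_has_integral mI mf _ sf) => t _.
  by rewrite ger0_norm// lerDl.
have fN := has_integralN11_oppr (fun t _ => f0 t) fi.
have := has_integral_Rintegral (has_integralD mI fi fN).
rewrite (has_integral_Rintegral sf) => vE; split; first by case: fi.
by rewrite -/f; lra.
Qed.

(** The general formula would meet the pole of Gamma at 0 when d = 1; there [phi] sums over theta =
    -1 and 1, and the constant is that of [expR2D_bessel_clifford]. *)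
Definition vMF_const d : R := if d == 1%N then 2 * Num.sqrt pi
  else Num.sqrt pi * euler_gamma ((d%:R - 1) / 2).

Lemma phi_vMF d r s : (0 < d)%N -> 0 <= r * s ->
  phi d (@L_vMF R) r s =
    vMF_const d * (expR (- (r + s)) * bessel_clifford (d%:R / 2) (r * s)).
Proof.
move=> d0 rs; rewrite /phi /vMF_const; case: ifPn => [/eqP->|d1].
  rewrite /L_vMF !opprD !opprK expRD [X in _ + X]expRD -mulrDr.
  rewrite expR2D_bessel_clifford sqr_sqrtr//.
  by rewrite mul1r; ring.
have [n ->] : exists n, d = n.+2 by case: d d0 d1 => [|[|n]]//; exists n.
have h := has_integral_beta_expR n (Num.sqrt (r * s)).
have mI : measurable I11 by exact: measurable_itv.
have nE : n.+2%:R = n.+1%:R + 1 :> R by rewrite natr1.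
have /(has_integralZl (expR (- (r + s))) mI) := h.
rewrite sqr_sqrtr// => h'.
have h'' : has_integral I11 (fun t => (1 - t ^+ 2) `^ ((n.+2%:R - 3) / 2) *
    L_vMF (r + s - 2 * t * Num.sqrt (r * s))) (expR (- (r + s)) *
    (Num.sqrt pi * euler_gamma (n.+1%:R / 2) *
     bessel_clifford (2^-1 + n.+1%:R / 2) (r * s))).
  apply: (eq_has_integral mI _ h') => t _.
  rewrite mulrCA; congr (_ * _); first by congr powR; rewrite nE; field.
  by rewrite /L_vMF opprB -expRD; congr expR; ring.
rewrite /Rintegral integral_itv_bndoo; last first.
  by apply/measurable_EFinP; exact: has_integral_measurable h''.
rewrite (has_integralE mI h'')/=.
have -> : 2^-1 + n.+1%:R / 2 = n.+2%:R / 2 :> R by rewrite nE; field.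
have -> : (n.+2%:R - 1) / 2 = n.+1%:R / 2 :> R by rewrite nE; field.
ring.
Qed.

Lemma phi1_vMF d u v : (0 < d)%N -> 0 < u -> 0 < v ->
  phi1 d (@L_vMF R) u v = vMF_const d * (expR (- (u + v)) *
    (v * bessel_clifford (d%:R / 2 + 1) (u * v)
     - bessel_clifford (d%:R / 2) (u * v))).
Proof.
move=> d0 u0 v0; have a0 : 0 < d%:R / 2 :> R by rewrite divr_gt0// ltr0n.
set c := vMF_const d; set a := d%:R / 2 in a0 *.
have d2 : is_derive u 1 (fun x : R => x * v) v.
  by apply: trigger_derive; rewrite /GRing.scale/=; ring.
have d3 := @is_derive1_comp R (bessel_clifford a) (fun x : R => x * v) u _ _
  (is_derive_bessel_clifford (u * v) a0) d2.
have d1 : is_derive u 1 (fun x : R => expR (- (x + v))) (- expR (- (u + v))).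
  by apply: trigger_derive; ring.
have d4 := is_deriveM (is_derive_cst c u 1) (is_deriveM d1 d3).
rewrite /phi1 derive1E.
suff [_ ->] : is_derive u 1 (fun x => phi d (@L_vMF R) x v) (c * (expR (- (u + v)) *
    (v * bessel_clifford (a + 1) (u * v) - bessel_clifford a (u * v)))) by [].
(* The closed form of [phi] requires a nonnegative product, which holds in a neighbourhood of u
   because u and v are positive. *)
apply: near_eq_is_derive; last first.
  apply: (is_derive_eq d4); rewrite /GRing.scale/=; ring.
near=> x; have x0 : 0 < x by near: x; exact: lt_nbhsr.
by rewrite phi_vMF// mulr_ge0 ?ltW.
Unshelve. all: by end_near. Qed.

Lemma phi12_vMF d u v : (0 < d)%N -> 0 < u -> 0 < v ->
  phi12 d (@L_vMF R) u v = vMF_const d * (expR (- (u + v)) *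
    (bessel_clifford (d%:R / 2) (u * v)
     + (1 - u - v) * bessel_clifford (d%:R / 2 + 1) (u * v)
     + u * v * bessel_clifford (d%:R / 2 + 2) (u * v))).
Proof.
move=> d0 u0 v0; have a0 : 0 < d%:R / 2 :> R by rewrite divr_gt0// ltr0n.
set c := vMF_const d; set a := d%:R / 2 in a0 *.
have a1 : 0 < a + 1 by rewrite addr_gt0.
have a2E : a + 2 = a + 1 + 1 by ring.
have d2 : is_derive v 1 (fun x : R => u * x) u.
  by apply: trigger_derive; rewrite /GRing.scale/=; ring.
have d3 := is_derive1_comp (is_derive_bessel_clifford (u * v) a0) d2.
have d3' := is_derive1_comp (is_derive_bessel_clifford (u * v) a1) d2.
have d1 : is_derive v 1 (fun x : R => expR (- (u + x))) (- expR (- (u + v))).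
  by apply: trigger_derive; ring.
have d4 := is_deriveM (is_derive_cst c v 1)
  (is_deriveM d1 (is_deriveB (is_deriveM (is_derive_id v 1) d3') d3)).
rewrite /phi12 derive1E.
suff [_ ->] : is_derive v 1 (phi1 d (@L_vMF R) u) (c * (expR (- (u + v)) *
    (bessel_clifford a (u * v) + (1 - u - v) * bessel_clifford (a + 1) (u * v)
     + u * v * bessel_clifford (a + 2) (u * v)))) by [].
apply: near_eq_is_derive; last first.
  apply: (is_derive_eq d4); rewrite a2E !fctE /GRing.scale/=; ring.
near=> x; have x0 : 0 < x by near: x; exact: lt_nbhsr.
by rewrite phi1_vMF.
Unshelve. all: by end_near. Qed.

End vMF_kernel.

(** * The functionals of the von Mises-Fisher kernel *)


Section vMF_functionals.
Context {R : realType} (d : nat).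
Hypothesis d_gt0 : (0 < d)%N.
Notation L := (@L_vMF R).
Notation a := (d%:R / 2 : R).
(** After every shifted power is expanded, the functionals are rational in d, T, P, Q and [Ga],
    which [field] can treat as atoms. *)
Notation T := ((2 : R) `^ a).
Notation P := ((pi : R) `^ a).
Notation Q := ((3 / 2 : R) `^ a).
Notation Ga := (euler_gamma a).
Notation B := bessel_clifford.
Implicit Types (s t u v w : R).

Let m0y : measurable (`]0, +oo[%classic : set (measurableTypeR R)).
Proof. exact: measurable_itv. Qed.
Let d0 : (0 : R) < d%:R. Proof. by rewrite ltr0n. Qed.
Let a_gt0 : 0 < a. Proof. by rewrite divr_gt0. Qed.
Let a1_gt0 : 0 < a + 1. Proof. by rewrite addr_gt0. Qed.
Let a2_gt0 : 0 < a + 2. Proof. by rewrite addr_gt0. Qed.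
Let T_gt0 : 0 < T. Proof. exact: powR_gt0. Qed.
Let P_gt0 : 0 < P. Proof. exact/powR_gt0/pi_gt0. Qed.
Let Q_gt0 : 0 < Q. Proof. exact: powR_gt0. Qed.
Let Ga_gt0 : 0 < Ga. Proof. exact: Gamma_gt0. Qed.

Let GaD1 : euler_gamma (a + 1) = a * Ga. Proof. exact: GammaD1. Qed.
Let GaD2 : euler_gamma (a + 2) = (a + 1) * (a * Ga).
Proof. by rewrite -GaD1 -GammaD1//; congr euler_gamma; ring. Qed.

Lemma powRDn (x : R) n : 0 < x -> x `^ (a + n%:R) = x `^ a * x ^+ n.
Proof. by move=> x0; rewrite gt0_powRD// powR_mulrn// ltW. Qed.

Lemma powRD1 (x : R) : 0 < x -> x `^ (a + 1) = x `^ a * x.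
Proof. by move=> x0; rewrite gt0_powRD// powRr1// ltW. Qed.

Lemma omega_pred : omega R d.-1 = 2 * P / Ga.
Proof. by rewrite /omega natr1 prednK// euler_gamma.unlock. Qed.

Lemma powR2B1 : (2 : R) `^ (a - 1) = T / 2.
Proof. by rewrite gt0_powRD// powRN powRr1. Qed.

Lemma lambdaE (f : R -> R) v :
  has_integral `]0, +oo[ (fun s => f s * s `^ (a - 1)) v ->
  lambda d f = T * P * v / Ga.
Proof.
move=> /has_integral_int0oo fv; rewrite /lambda fv omega_pred powR2B1.
by field; rewrite gt_eqF.
Qed.

Lemma lambda_vMF : lambda d L = T * P.
Proof.
rewrite (@lambdaE _ (Ga / 1 `^ a)).
  by rewrite powR1 divr1; field; rewrite gt_eqF.
have := has_integral_powR_expR a_gt0 (ltr01 : 0 < 1 :> R).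
by apply: eq_has_integral0y => s _; rewrite mul1r mulrC.
Qed.

Lemma lambda_vMF_sqr : lambda d (fun t => L t ^+ 2) = P.
Proof.
rewrite (@lambdaE _ (Ga / T)); first by field; rewrite !gt_eqF.
have := has_integral_powR_expR a_gt0 (ltr0Sn R 1).
apply: eq_has_integral0y => s _.
by rewrite /L_vMF expr2 -expRD mulrC; congr (expR _ * _); ring.
Qed.

Lemma lambda_G_vMF_sqr :
  lambda d (fun t => G L t ^+ 2) = P * (d%:R * (d%:R + 2)) / 16.
Proof.
rewrite (@lambdaE _ (euler_gamma (a + 2) / 2 `^ (a + 2))).
  by rewrite powRDn// GaD2; field; rewrite !gt_eqF.
have := has_integral_powR_expR a2_gt0 (ltr0Sn R 1).
apply: eq_has_integral0y => s s0.
rewrite /G; have -> : derive1 L s = - expR (- s).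
  rewrite derive1E; suff [_ ->] : is_derive s 1 L (- expR (- s)) by [].
  by apply: trigger_derive; ring.
have -> : s `^ (a + 2 - 1) = s `^ (a - 1) * s ^+ 2.
  by rewrite -(powR_mulrn 2 (ltW s0)) -gt0_powRD//; congr powR; ring.
have -> : expR (- (2 * s)) = expR (- s) ^+ 2
  by rewrite expr2 -expRD; congr expR; ring.
ring.
Qed.

Lemma beta2_vMF : beta2 d L = d%:R * (T * P).
Proof.
rewrite /beta2 omega_pred (@has_integral_int0oo _ _ (euler_gamma (a + 1) / 1 `^ (a + 1))).
  by rewrite powR1 divr1 GaD1; field; rewrite gt_eqF.
have := has_integral_powR_expR a1_gt0 (ltr01 : 0 < 1 :> R).
by apply: eq_has_integral0y => s _; rewrite mul1r mulrC addrK.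
Qed.

Lemma v_vMF : v_ d L = (T ^+ 2 * P)^-1.
Proof. by rewrite /v_ lambda_vMF lambda_vMF_sqr; field; rewrite !gt_eqF. Qed.

Lemma b_vMF : b_ d L = 2^-1.
Proof. by rewrite /b_ lambda_vMF beta2_vMF; field; rewrite !gt_eqF. Qed.

(** * The three terms of sigma_0^2 and their constants *)

Notation c := (@vMF_const R d).

Lemma inner_phi1_vMF v : 0 < v ->
  int0oo (fun u => L u * phi1 d L u v * u `^ a) =
    c / (4 * T) * (expR (- v) * expR (v / 2)) * (v - 2 * a).
Proof.
move=> v0; apply: has_integral_int0oo; have two0 := ltr0Sn R 1.
(* The rate 2 joins exp(-u) from [L u] with exp(-u) from [phi1]. The weight u^a matches the index a
   + 1; the part of index a takes the shifted transform. *)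
have h1 := has_integralZl v m0y (has_integral_bessel_clifford a1_gt0 two0 (ltW v0)).
have h0 := has_integral_bessel_clifford_shift a_gt0 two0 (ltW v0).
have h := has_integralZl (c * expR (- v)) m0y (has_integralB m0y h1 h0).
have -> : c / (4 * T) * (expR (- v) * expR (v / 2)) * (v - 2 * a) =
  c * expR (- v) * (v * (expR (v / 2) / 2 `^ (a + 1)) -
    (a / 2 `^ (a + 1) + v / 2 `^ (a + 2)) * expR (v / 2)).
  by rewrite powRD1// powRDn//; field; rewrite gt_eqF.
apply: eq_has_integral0y h => u u0; rewrite phi1_vMF// /L_vMF addrK.
have -> : expR (- (2 * u)) = expR (- u) * expR (- u)
  by rewrite -expRD; congr expR; ring.
by rewrite opprD expRD; ring.
Qed.

(** Expanding (v - 2a)^2 against v^(a-1) exp(-v), the last two Gamma integrals cancel, -4a^2 + 4a^2,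
    and only Gamma(a + 2) remains. *)
Lemma third_term_vMF :
  int0oo (fun v => int0oo (fun u => L u * phi1 d L u v * u `^ a) ^+ 2
    * v `^ (a - 1)) = c ^+ 2 / (16 * T ^+ 2) * (a * (a + 1) * Ga).
Proof.
apply: has_integral_int0oo; have one0 := ltr01 : 0 < 1 :> R.
have h2 := has_integral_powR_expR a2_gt0 one0.
have h1 := has_integralZl (4 * a) m0y (has_integral_powR_expR a1_gt0 one0).
have h0 := has_integralZl (4 * a ^+ 2) m0y (has_integral_powR_expR a_gt0 one0).
have h := has_integralZl (c ^+ 2 / (16 * T ^+ 2)) m0y
  (has_integralD m0y (has_integralB m0y h2 h1) h0).
have -> : a * (a + 1) * Ga = euler_gamma (a + 2) / 1 `^ (a + 2) -
  4 * a * (euler_gamma (a + 1) / 1 `^ (a + 1)) + 4 * a ^+ 2 * (Ga / 1 `^ a).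
  by rewrite powR1 !divr1 GaD2 GaD1; ring.
apply: eq_has_integral0y h => v v0; rewrite inner_phi1_vMF// !mul1r.
have -> : expR (- v) * expR (v / 2) = expR (- (v / 2))
  by rewrite -expRD; congr expR; field.
have -> : expR (- v) = expR (- (v / 2)) ^+ 2
  by rewrite expr2 -expRD; congr expR; field.
have -> : v `^ (a + 1 - 1) = v `^ (a - 1) * v.
  by rewrite -{3}(powRr1 (ltW v0)) -gt0_powRD//; congr powR; ring.
have -> : v `^ (a + 2 - 1) = v `^ (a - 1) * v ^+ 2.
  by rewrite -(powR_mulrn 2 (ltW v0)) -gt0_powRD//; congr powR; ring.
by field; rewrite gt_eqF.
Qed.

Lemma inner_phi12_vMF v : 0 < v ->
  int0oo (fun u => L u * L v * phi12 d L u v * u `^ a * v `^ a) =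
    c / (8 * T) * (v `^ a * expR (- (3 / 2 * v))) * (2 * a + 2 - v).
Proof.
move=> v0; apply: has_integral_int0oo; have two0 := ltr0Sn R 1.
(* The factor 1 - u - v is split: 1 - v keeps the matched weight u^a for the index a + 1, while -u
   raises it and calls for the shifted transform. The product u v matches the index a + 2. *)
have h0 := has_integral_bessel_clifford_shift a_gt0 two0 (ltW v0).
have h1 := has_integralZl (1 - v) m0y (has_integral_bessel_clifford a1_gt0 two0 (ltW v0)).
have h1' := has_integral_bessel_clifford_shift a1_gt0 two0 (ltW v0).
have h2 := has_integralZl v m0y (has_integral_bessel_clifford a2_gt0 two0 (ltW v0)).
have h := has_integralZl (c * expR (- v) ^+ 2 * v `^ a) m0y
  (has_integralD m0y (has_integralB m0y (has_integralD m0y h0 h1) h1') h2).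
have a3E : a + 1 + 2 = a + 3 by ring.
have a2E : a + 1 + 1 = a + 2 by ring.
have -> : c / (8 * T) * (v `^ a * expR (- (3 / 2 * v))) * (2 * a + 2 - v) =
  c * expR (- v) ^+ 2 * v `^ a *
  ((a / 2 `^ (a + 1) + v / 2 `^ (a + 2)) * expR (v / 2) +
   (1 - v) * (expR (v / 2) / 2 `^ (a + 1)) -
   ((a + 1) / 2 `^ (a + 1 + 1) + v / 2 `^ (a + 1 + 2)) * expR (v / 2) +
   v * (expR (v / 2) / 2 `^ (a + 2))).
  rewrite a3E a2E powRD1// !powRDn//.
  have -> : expR (- (3 / 2 * v)) = expR (- v) ^+ 2 * expR (v / 2).
    by rewrite expr2 -!expRD; congr expR; field.
  by field; rewrite gt_eqF.
apply: eq_has_integral0y h => u u0; rewrite phi12_vMF// /L_vMF addrK.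
have -> : expR (- (2 * u)) = expR (- u) ^+ 2
  by rewrite expr2 -expRD; congr expR; ring.
have -> : a + 2 - 1 = a + 1 by ring.
by rewrite opprD expRD gt0_powRD// powRr1 ?(ltW u0)//; ring.
Qed.

(** The rate 3/2, source of the powers of 3/2 in the result, is 2 - 1/2: exp(-v) from [L v] and from
    [phi12], against exp(v/2) from the inner transform. The 9 comes from 4/3 - 4/9 = 8/9 and the
    prefactor 1/8. *)
Lemma second_term_vMF :
  int0oo (fun v => int0oo (fun u =>
    L u * L v * phi12 d L u v * u `^ a * v `^ a)) =
  c / (9 * T * Q) * (a * (a + 1) * Ga).
Proof.
apply: has_integral_int0oo; have th0 : 0 < 3 / 2 :> R by rewrite divr_gt0.
have h1 := has_integralZl (2 * a + 2) m0y (has_integral_powR_expR a1_gt0 th0).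
have h2 := has_integral_powR_expR a2_gt0 th0.
have h := has_integralZl (c / (8 * T)) m0y (has_integralB m0y h1 h2).
have -> : c / (9 * T * Q) * (a * (a + 1) * Ga) = c / (8 * T) *
  ((2 * a + 2) * (euler_gamma (a + 1) / (3 / 2) `^ (a + 1))
   - euler_gamma (a + 2) / (3 / 2) `^ (a + 2)).
  by rewrite powRD1// powRDn// GaD2 GaD1; field; rewrite !gt_eqF.
apply: eq_has_integral0y h => v v0; rewrite inner_phi12_vMF// addrK.
have -> : v `^ (a + 2 - 1) = v `^ a * v.
  by rewrite -{3}(powRr1 (ltW v0)) -gt0_powRD//; congr powR; ring.
ring.
Qed.

(** Gamma((d-1)/2) occurs in the numerator of c and the denominator of omega_(d-2). Both enter
    [gamma * c] once and [gammat * c ^+ 2] twice, so neither is needed separately. *)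
Lemma omega_pred2_vMF_const : (1 < d)%N -> omega R d.-2 * c = 2 * P.
Proof.
move=> d1; have dE : d.-2%:R + 1 = d%:R - 1 :> R.
  by case: d d1 => [|[|n]]// _; rewrite /= -(@natr1 _ n.+1) addrK natr1.
have b0 : 0 < (d%:R - 1) / 2 :> R by rewrite divr_gt0// subr_gt0 ltr1n.
have GE (x : R) : Gamma x = euler_gamma x by rewrite euler_gamma.unlock.
rewrite /omega dE GE /vMF_const gtn_eqF//.
have -> : P = pi `^ ((d%:R - 1) / 2) * Num.sqrt pi.
  rewrite -powR12_sqrt ?pi_ge0// -gt0_powRD ?pi_gt0//.
  by congr powR; field.
have G0 := Gamma_gt0 b0.
by field; rewrite gt_eqF.
Qed.

Lemma vMF_d1 : d = 1%N -> [/\ T ^+ 2 = 2, P = Num.sqrt pi, Ga = Num.sqrt pi &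
  c = 2 * Num.sqrt pi].
Proof.
move=> d1; rewrite /vMF_const d1 eqxx mul1r Gamma_half.
by rewrite !powR12_sqrt ?pi_ge0// sqr_sqrtr.
Qed.

(** Both factors are defined by cases, yet the product is uniform in d: at d = 1 both sides equal 2
    sqrt(pi), and for d >= 2 the omegas combine as 2^(d-2) = T^2 / 4. *)
Lemma gamma_vMF_const : gamma R d * c = T ^+ 2 * P ^+ 2 / Ga.
Proof.
rewrite /gamma; have sp0 : 0 < Num.sqrt pi :> R by rewrite sqrtr_gt0 pi_gt0.
case: ifPn => [/eqP/vMF_d1[-> -> -> ->]|d1].
  by field; rewrite gt_eqF.
have d2 : (1 < d)%N by rewrite ltn_neqAle eq_sym d1.
have -> : 2 `^ (d%:R - 2) = T ^+ 2 / 4 :> R.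
  rewrite (_ : d%:R - 2 = a + a - 2); last by field.
  by rewrite !gt0_powRD// powRN powR_mulrn//; field.
rewrite omega_pred; move: (omega R d.-2) (omega_pred2_vMF_const d2) => o oc.
rewrite (_ : _ * c = 2 * P / Ga * (o * c) * (T ^+ 2 / 4)); last by ring.
by rewrite oc; field; rewrite gt_eqF.
Qed.

Lemma gammat_vMF_const : gammat R d * c ^+ 2 = T ^+ 3 * P ^+ 3 / Ga.
Proof.
rewrite /gammat; have sp0 : 0 < Num.sqrt pi :> R by rewrite sqrtr_gt0 pi_gt0.
case: ifPn => [/eqP d1|d1].
  have [T2 PE GE ->] := vMF_d1 d1; rewrite PE GE (exprS T) T2.
  have -> : 2 `^ (- 2^-1) = T / 2 :> R.
    have -> : 2 `^ (- 2^-1) = T^-1 :> R by rewrite powRN d1 mul1r.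
    apply: (@mulfI _ T); rewrite ?gt_eqF// mulfV ?gt_eqF//.
    by rewrite mulrA -expr2 T2 divff.
  by field; rewrite gt_eqF.
have d2 : (1 < d)%N by rewrite ltn_neqAle eq_sym d1.
have -> : 2 `^ ((3 * d%:R - 6) / 2) = T ^+ 3 / 8 :> R.
  rewrite (_ : (3 * d%:R - 6) / 2 = a + a + a - 3); last by field.
  by rewrite !gt0_powRD// powRN powR_mulrn//; field.
rewrite omega_pred; move: (omega R d.-2) (omega_pred2_vMF_const d2) => o oc.
rewrite (_ : _ * c ^+ 2 = 2 * P / Ga * (o * c) ^+ 2 * (T ^+ 3 / 8));
  last by ring.
by rewrite oc; field; rewrite gt_eqF.
Qed.

Lemma sigma2_0_vMF : sigma2_0 d L = d%:R * (d%:R + 2) / (T ^+ 2 * P) *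
  (1 + 2 `^ (- (a + 2)) - 2 * (3 / 2) `^ (- (a + 2))).
Proof.
rewrite /sigma2_0 lambda_vMF lambda_G_vMF_sqr second_term_vMF third_term_vMF.
rewrite !powRN !powRDn//.
(* Regrouping brings [gamma] next to c, and below [gammat] next to c^2, since only these products
   have a closed form uniform in d. *)
have -> : 2 * gamma R d / (T * P) ^+ 3 * (c / (9 * T * Q) * (a * (a + 1) * Ga)) =
  2 * (gamma R d * c) / (T * P) ^+ 3 / (9 * T * Q) * (a * (a + 1) * Ga).
  by field; rewrite !gt_eqF.
have -> : gammat R d / (T * P) ^+ 4 *
    (c ^+ 2 / (16 * T ^+ 2) * (a * (a + 1) * Ga)) =
  (gammat R d * c ^+ 2) / (T * P) ^+ 4 / (16 * T ^+ 2) * (a * (a + 1) * Ga).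
  by field; rewrite !gt_eqF.
rewrite gamma_vMF_const gammat_vMF_const.
by field; rewrite !gt_eqF.
Qed.

End vMF_functionals.

Theorem corollary3p1 (R : realType) (d : nat) (hd : (1 <= d)%N) :
  tau d (@L_vMF R) =
    2 `^ ((5 * d%:R + 4) / (d%:R + 4)) * pi `^ (2 * d%:R / (d%:R + 4))
    / d%:R `^ ((d%:R + 8) / (d%:R + 4))
    * (1 + 2 `^ (- (d%:R / 2 + 2)) - 2 * (3 / 2) `^ (- (d%:R / 2 + 2)))
    * (d%:R * (d%:R + 2) / (d%:R + 4) ^+ 2).
Proof.
have d0 : (0 : R) < d%:R by rewrite ltr0n.
have d4 : (0 : R) < d%:R + 4 by rewrite addr_gt0.
have pi0 := @pi_gt0 R.
rewrite /tau sigma2_0_vMF// v_vMF// b_vMF//.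
set S := 1 + _ - _; set X := (2 `^ (d%:R - 4) * _) `^ _;
  set Y := (_ * _) `^ (1 / _).
set W := _ ^+ 2 * pi `^ _.
have W0 : 0 < W by rewrite mulr_gt0 ?exprn_gt0 ?powR_gt0.
have X0 : 0 < X by rewrite powR_gt0// mulr_gt0 ?powR_gt0 ?exprn_gt0.
have Y0 : 0 < Y by rewrite powR_gt0// mulr_gt0 ?exprn_gt0 ?invr_gt0.
(* X is the prefactor of [tau], Y comes from [v_] and [b_], W from [sigma2_0]. All are products of
   powers of 2, pi and d; written as one exponential, the claim is an identity linear in ln 2, ln pi
   and ln d, with coefficients rational in d. *)
have key : (X * Y * W)^-1 = 2 `^ ((5 * d%:R + 4) / (d%:R + 4)) *
    pi `^ (2 * d%:R / (d%:R + 4)) / d%:R `^ ((d%:R + 8) / (d%:R + 4)).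
  have pE (x e : R) : 0 < x -> x `^ e = expR (ln x * e).
    by move=> x0; rewrite expRM lnK.
  have nE (x : R) n : 0 < x -> x ^+ n = expR (ln x * n%:R).
    by move=> x0; rewrite -pE// powR_mulrn// ltW.
  rewrite /X /Y /W [2^-1 ^+ _]exprVn.
  rewrite !(pE 2)// !(pE pi)// !(pE d%:R)// !(nE d%:R)// (nE 2)//.
  rewrite -!(expRM_natl, expRD, expRN, expRM); congr expR.
  rewrite (natrD _ d 8) (natrM _ 2 d); field.
  by rewrite gt_eqF.
by rewrite -key; field; rewrite !gt_eqF.
Qed.
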